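(* Let $X^h(t)=(x_1^h(t),\dots,x_N^h(t))$ be an absolutely continuous solution on $[0,T]$, with values in $\Omega^N$, of $$\dot x_i^h(t)=v_i^h(t)+\alpha(t)\left(c_i(X^h(t))-x_i^h(t)\right),\qquad 1\le i\le N,$$ where $\alpha\in L^1(0,T)$ is nonnegative and $v_i^h\in L^1((0,T);\mathbb R^2)$. Assume that the generators $x_1^h(t),\dots,x_N^h(t)$ remain pairwise distinct on $[0,T]$, and let $\{\Omega_i^h(t)\}_{1\le i\le N}$ be the associated Voronoi cells, $\Omega_i^h(t):=\Omega_i(X^h(t))$. Let $\mu^h(t):=\rho^h(t,\cdot)\,dx$, where $$\rho^h(t,x):=\sum_{i=1}^N\frac{M_i^h}{|\Omega_i^h(t)|}\mathbf 1_{\Omega_i^h(t)}(x),\qquad M_i^h:=\int_{\Omega_i^h(0)}\rho_0\,dx,\qquad M:=\sum_{i=1}^N M_i^h=\int_\Omega\rho_0\,dx .$$ Let $d_h:=\sup_{t\in[0,T]}\mathscr D(X^h(t))$, let $\mathscr E_h(t):=\sum_{i=1}^N M_i^h\,|v_i^h(t)-v(t,x_i^h(t))|$, and let $$B_h(t):=\int_0^t e^{\Lambda(t)-\Lambda(s)}\alpha(s)\sum_{i=1}^N M_i^h\left|c_i(X^h(s))-x_i^h(s)\right|ds .$$ Then, for every $t\in[0,T]$, $$W_1\left(\mu^h(t),\mu(t)\right)\le M\left(1+e^{\Lambda(t)}\right)d_h+\int_0^t e^{\Lambda(t)-\Lambda(s)}\mathscr E_h(s)\,ds+B_h(t).$$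 In particular, for a family of such solutions indexed by $h\to0$ (where $N$, $\alpha$ and $v_i^h$ may depend on $h$), if $d_h\to0$, $\int_0^T\mathscr E_h(s)\,ds\to0$ and $B_h(T)\to0$, then $$\sup_{t\in[0,T]}W_1(\mu^h(t),\mu(t))\to0.$$
   Context: Domain. $T>0$ is finite. $\Omega$ is either a bounded convex Lipschitz domain of $\mathbb R^2$ or a flat torus $\Omega=\mathbb R^2/\mathcal L$, where $\mathcal L=\mathbb Z\ell_1+\mathbb Z\ell_2$ with $\ell_1,\ell_2\in\mathbb R^2$ linearly independent. On the torus, $|x-y|=\min_{k\in\mathcal L}|\tilde x-\tilde y-k|$ denotes the torus distance ($\tilde x,\tilde y\in\mathbb R^2$ representatives, Euclidean norm on the right); balls and diameters are understood accordingly, and functions on $\Omega$ are identified with $\mathcal L$-periodic functions on $\mathbb R^2$. Voronoi tessellation. For $X=(x_1,\dots,x_N)\in\Omega^N$ with pairwise distinct entries (generators), $\Omega_i(X):=\{x\in\Omega: |x-x_i|<|x-x_j|\ \text{for all } j\ne i\}$, $V_i(X):=|\Omega_i(X)|$, and $c_i(X):=V_i(X)^{-1}\int_{\Omega_i(X)}x\,dx$ is the centroid. On the torus, the displacement $c_i(X)-x_i\in\mathbb R^2$ is defined by $c_i-x_i=\frac1{V_i}\int_{P_i}(y-x_i)\,dy$, where, for representatives $x_j\in\mathbb R^2$, $P_i:=\{y\in\mathbb R^2:\ |y-x_i|\le|y-x_j-k|\ \text{for all } 1\le j\le N,\ k\in\mathcal L\}$ (Euclidean norms); it does not depend on the chosen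 representatives. $\mathscr D(X):=\max_{1\le i\le N}\operatorname{diam}(\Omega_i(X))$. The mesh size is $h:=\sqrt{|\Omega|/N}$. Velocity and continuity equation. $v\in L^1((0,T);C^{0,1}(\Omega;\mathbb R^2))$, with $v\cdot n=0$ on $\partial\Omega$ when $\Omega$ is a bounded domain ($n$ the outer normal). $L(t):=\|v(t,\cdot)\|_{C^{0,1}(\Omega)}$ (in particular $v(t,\cdot)$ is $L(t)$-Lipschitz) and $\Lambda(t):=\int_0^tL(s)\,ds$. $\rho_0\in L^1(\Omega)$, $\rho_0\ge0$. $\mu(t):=\rho(t,\cdot)\,dx=\Phi(t,\cdot)_\#\mu(0)$, $\mu(0)=\rho_0\,dx$, where $\Phi$ is the flow of $v$; equivalently $\rho$ is the unique weak solution of $\partial_t\rho+\nabla\cdot(\rho v)=0$ in $(0,T)\times\Omega$ with initial datum $\rho_0$. Wasserstein distance. For nonnegative measures $\mu,\nu$ on $\Omega$ of equal mass, $W_1(\mu,\nu):=\inf_{\pi\in\Pi(\mu,\nu)}\int_{\Omega\times\Omega}|x-y|\,d\pi(x,y)$, where $\Pi(\mu,\nu)$ is the set of nonnegative measures on $\Omega\times\Omega$ with first marginal $\mu$ and second marginal $\nu$. *)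

(* Defs.v *)
From HB Require Import structures.
From mathcomp Require Import all_boot all_order all_algebra.
From mathcomp Require Import all_classical all_reals all_analysis.

Set Implicit Arguments.
Unset Strict Implicit.
Unset Printing Implicit Defensive.

Import Order.TTheory GRing.Theory Num.Theory numFieldNormedType.Exports.

Local Open Scope classical_set_scope.
Local Open Scope ring_scope.

(* [measurableTypeR R] is [R] with the Borel sets, on which the library defines
   [lebesgue_measure]. *)
Definition plane (R : realType) := (measurableTypeR R * measurableTypeR R)%type.

(* The norm of the library on a product is the sup norm, hence [enorm]. *)
Definition dot (R : realType) (x y : plane R) : R := x.1 * y.1 + x.2 * y.2.

Definition enorm (R : realType) (x : plane R) : R :=
  Num.sqrt (x.1 ^+ 2 + x.2 ^+ 2).

Definition leb1 (R : realType) : {measure set (measurableTypeR R) -> \bar R} :=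
  @lebesgue_measure R.

Definition leb2 (R : realType) : {measure set (plane R) -> \bar R} :=
  ((@lebesgue_measure R) \x (@lebesgue_measure R))%E.

Definition vintegral (R : realType) (A : set (plane R))
    (f : plane R -> plane R) : plane R :=
  (\int[leb2 R]_(x in A) (f x).1, \int[leb2 R]_(x in A) (f x).2).

Definition vderive (R : realType) (f : R -> plane R) (t : R) (p : plane R) :=
  is_derive t (1 : R) (fun s => (f s).1 : R) p.1 /\
  is_derive t (1 : R) (fun s => (f s).2 : R) p.2.

Definition vintegrable (R : realType) (A : set R) (f : R -> plane R) :=
  (leb1 R).-integrable A (fun t => ((f t).1 : R)%:E) /\
  (leb1 R).-integrable A (fun t => ((f t).2 : R)%:E).

Definition absolutely_continuous_on (R : realType) (a b : R)
    (f : R -> plane R) :=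
  forall e : R, 0 < e -> exists2 d : R, 0 < d &
  forall (n : nat) (l u : 'I_n -> R),
    (forall i, a <= l i /\ l i <= u i /\ u i <= b) ->
    trivIset setT (fun i => `]l i, u i[%classic) ->
    \sum_(i < n) (u i - l i) < d ->
    \sum_(i < n) enorm (f (u i) - f (l i)) < e.

(* [U] coincides near [p] with the strict epigraph of the Lipschitz function
   [g], in the orthonormal frame [(e1, e2)] with origin [p]. *)
Definition lipschitz_chart (R : realType) (U : set (plane R))
    (p e1 e2 : plane R) (g : R -> R) :=
  [/\ enorm e1 = 1, enorm e2 = 1, dot e1 e2 = 0 &
  exists r d : R, [/\ 0 < r, 0 < d, [lipschitz g s | s in `]- r, r[] &
    forall s t : R, `|s| < r -> `|t| < d ->
      U (p + s *: e1 + t *: e2) <-> g s < t]].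

Definition frontier (R : realType) (U : set (plane R)) : set (plane R) :=
  closure U `\` interior U.

Definition lipschitz_boundary (R : realType) (U : set (plane R)) :=
  forall p, frontier U p -> exists e1 e2 g, lipschitz_chart U p e1 e2 g.

Definition outer_normal (R : realType) (U : set (plane R)) (p n : plane R) :=
  exists e1 e2 g (m : R), [/\ lipschitz_chart U p e1 e2 g,
    is_derive (0 : R) (1 : R) g m &
    n = (Num.sqrt (1 + m ^+ 2))^-1 *: (m *: e1 - e2)].

Definition lattice (R : realType) (l1 l2 : plane R) : set (plane R) :=
  [set k | exists a b : int, k = a%:~R *: l1 + b%:~R *: l2].

(* A point of the torus [R^2/L] is given by any representative in [R^2], a
   function on it by an [L]-periodic function, and a measure on it by a measure
   on [R^2] carried by the half-open fundamental cell [carrier]. *)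
Inductive domain (R : realType) :=
| BoundedDomain (U : set (plane R))
| FlatTorus (l1 l2 : plane R).

Section Domain.
Context {R : realType}.
Implicit Types (D : domain R) (x y p : plane R).

Definition admissible_domain D : Prop :=
  match D with
  | BoundedDomain U => [/\ U !=set0, open U, bounded_set U, convex_set U &
                           lipschitz_boundary U]
  | FlatTorus l1 l2 => forall a b : R, a *: l1 + b *: l2 = 0 -> a = 0 /\ b = 0
  end.

Definition carrier D : set (plane R) :=
  match D with
  | BoundedDomain U => U
  | FlatTorus l1 l2 => [set x | exists a b : R,
      [/\ 0 <= a < 1, 0 <= b < 1 & x = a *: l1 + b *: l2]]
  end.

Definition representative D : set (plane R) :=
  match D with
  | BoundedDomain U => U
  | FlatTorus _ _ => setT
  end.

Definition same_point D x y : Prop :=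
  match D with
  | BoundedDomain _ => x = y
  | FlatTorus l1 l2 => lattice l1 l2 (x - y)
  end.

Definition periodic D (f : plane R -> plane R) : Prop :=
  match D with
  | BoundedDomain _ => True
  | FlatTorus l1 l2 => forall x k, lattice l1 l2 k -> f (x + k) = f x
  end.

(* the representative in [carrier D] of the point given by [x] *)
Definition reduce D x : plane R :=
  xget x [set y | carrier D y /\ same_point D x y].

Definition dist D x y : R :=
  match D with
  | BoundedDomain _ => enorm (x - y)
  | FlatTorus l1 l2 => inf [set enorm (x - y - k) | k in lattice l1 l2]
  end.

Definition diam D (A : set (plane R)) : R :=
  sup [set d | exists x y, [/\ A x, A y & d = dist D x y]].

Definition area (A : set (plane R)) : R := fine (leb2 R A).

Definition mesh D (N : nat) : R := Num.sqrt (area (carrier D) / N%:R).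

Definition cell D N (X : 'I_N -> plane R) (i : 'I_N) : set (plane R) :=
  [set x | carrier D x /\ forall j, j != i -> dist D x (X i) < dist D x (X j)].

Definition polygon (l1 l2 : plane R) N (X : 'I_N -> plane R) (i : 'I_N) :
    set (plane R) :=
  [set y | forall j k, lattice l1 l2 k ->
             enorm (y - X i) <= enorm (y - X j - k)].

(* [c_i(X) - x_i] *)
Definition displacement D N (X : 'I_N -> plane R) (i : 'I_N) : plane R :=
  match D with
  | BoundedDomain _ =>
      (area (cell D X i))^-1 *: vintegral (cell D X i) id - X i
  | FlatTorus l1 l2 =>
      (area (cell D X i))^-1 *:
        vintegral (polygon l1 l2 X i) (fun y => y - X i)
  end.

Definition max_diam D N (X : 'I_N -> plane R) : R :=
  \big[Num.max/0]_(i < N) diam D (cell D X i).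

Definition C01norm D (f : plane R -> plane R) : \bar R :=
  (ereal_sup [set (enorm (f x))%:E | x in carrier D] +
   ereal_sup [set q | exists x y, [/\ carrier D x, carrier D y, x <> y &
                q = (enorm (f x - f y) / dist D x y)%:E]])%E.

(* On the boundary, the values of a Lipschitz field are its limits from the
   inside. *)
Definition tangential D (f : plane R -> plane R) : Prop :=
  match D with
  | BoundedDomain U => forall p n, frontier U p -> outer_normal U p n ->
      dot (f x) n @[x --> within U (nbhs p)] --> (0 : R)
  | FlatTorus _ _ => True
  end.

(* [v] is a representative with values in [C^{0,1}] of a class in
   [L^1((0,T); C^{0,1})]; only the functions [v(., x)] and the norm are required
   to be measurable, not [v] to be strongly measurable in the nonseparable
   space [C^{0,1}]. *)
Definition admissible_velocity D (T : R) (v : R -> plane R -> plane R) :=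
  [/\ forall x, representative D x ->
        measurable_fun `]0, T[ (fun t => v t x),
      forall t, 0 < t < T -> (C01norm D (v t) < +oo)%E,
      (leb1 R).-integrable `]0, T[ (fun t => C01norm D (v t)),
      forall t, 0 < t < T -> periodic D (v t) &
      {ae leb1 R, forall t, 0 < t < T -> tangential D (v t)}].

Definition Lam D (v : R -> plane R -> plane R) (t : R) : R :=
  fine (\int[leb1 R]_(s in `]0%R, t[) C01norm D (v s))%E.

(* On the torus, [Phi t x] is the lift to [R^2] of the trajectory of [x]. *)
Definition is_flow D (T : R) (v Phi : R -> plane R -> plane R) :=
  forall x, carrier D x ->
  [/\ Phi 0 x = x,
      forall t, 0 <= t <= T -> representative D (Phi t x),
      absolutely_continuous_on 0 T (fun t => Phi t x) &
      {ae leb1 R, forall t, 0 < t < T ->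
        vderive (fun s => Phi s x) t (v t (Phi t x))}].

Definition density D (rho : plane R -> R) (A : set (plane R)) : \bar R :=
  (\int[leb2 R]_(x in carrier D `&` A) (rho x)%:E)%E.

Definition transported D (rho0 : plane R -> R)
    (Phi : R -> plane R -> plane R) (t : R) : set (plane R) -> \bar R :=
  pushforward (density D rho0) (reduce D \o Phi t).

Definition coupling (mu nu : set (plane R) -> \bar R)
    (pi : {measure set (plane R * plane R) -> \bar R}) :=
  forall A : set (plane R), measurable A ->
    pi (A `*` setT) = mu A /\ pi (setT `*` A) = nu A.

Definition W1 D (mu nu : set (plane R) -> \bar R) : \bar R :=
  ereal_inf [set (\int[pi]_z (dist D z.1 z.2)%:E)%E | pi in coupling mu nu].

End Domain.

Section Scheme.
Context {R : realType} (D : domain R) (T : R).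
Variables (v : R -> plane R -> plane R) (rho0 : plane R -> R).
Variables (N : nat) (alpha : R -> R).
Variables (w X : 'I_N -> R -> plane R).

(* On the torus, [X i] is the lift to [R^2] of the trajectory of the
   generator. *)
Definition is_solution : Prop :=
  [/\ (leb1 R).-integrable `]0, T[ (fun t => (alpha t)%:E) /\
      (forall t, 0 < t < T -> 0 <= alpha t),
      (forall i, vintegrable `]0, T[ (w i)),
      (forall i, absolutely_continuous_on 0 T (X i) /\
                 forall t, 0 <= t <= T -> representative D (X i t)),
      (forall t, 0 <= t <= T ->
         forall i j, i != j -> ~ same_point D (X i t) (X j t)) &
      (forall i, {ae leb1 R, forall t, 0 < t < T ->
         vderive (X i) t
           (w i t + alpha t *: displacement D (fun j => X j t) i)})].

Definition conf (t : R) : 'I_N -> plane R := fun i => X i t.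

Definition mass (i : 'I_N) : R :=
  \int[leb2 R]_(x in cell D (conf 0) i) rho0 x.

Definition total_mass : R := \sum_(i < N) mass i.

Definition rhoh (t : R) (x : plane R) : R :=
  \sum_(i < N) mass i / area (cell D (conf t) i) * \1_(cell D (conf t) i) x.

Definition muh (t : R) : set (plane R) -> \bar R := density D (rhoh t).

Definition d_h : R := sup [set max_diam D (conf t) | t in `[0, T]].

Definition E_h (t : R) : R :=
  \sum_(i < N) mass i * enorm (w i t - v t (X i t)).

Definition B_h (t : R) : \bar R :=
  (\int[leb1 R]_(s in `]0%R, t[)
     (expR (Lam D v t - Lam D v s) * alpha s *
      \sum_(i < N) mass i * enorm (displacement D (conf s) i))%:E)%E.

End Scheme.

(* Main.v *)
Require Import Defs.
From HB Require Import structures.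
From mathcomp Require Import all_boot all_order all_algebra.
From mathcomp Require Import all_classical all_reals all_analysis.
From mathcomp Require Import ring lra zify measurable_realfun.
Import Order.TTheory GRing.Theory Num.Theory numFieldNormedType.Exports.
Local Open Scope classical_set_scope.
Local Open Scope ring_scope.

(** The two measures are compared cell by cell. The transported measure is the
    sum over i of the images under the flow of rho0 restricted to the initial
    cell of the i-th generator; the discrete measure is the sum over i of the
    uniform measures of the same masses M_i on the current cells. Any family of
    couplings of the i-th pieces adds up to a coupling of the whole measures,
    and the product couplings do: the i-th one only pairs points x of the
    current cell with points Phi_t(y), y in the initial cell, so that each unit
    of its mass costs at most |x - x_i(t)| + |x_i(t) - Phi_t(y)|
    ([W1_le_pieces]). A generator lies in its own cell, hence both
    |x - x_i(t)| and |x_i(0) - y| are at most d_h ([dist_generator_le]). The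
    generator is an approximate trajectory of the Lipschitz field v, with
    defect |w_i - v(x_i)| + alpha |c_i - x_i|, so Gronwall's inequality bounds
    |x_i(t) - Phi_t(y)| ([trajectory_dist_le]). Summing with the weights M_i
    gives the estimate ([W1_le]). Making the bound uniform in t ([W1_sup_le])
    gives the convergence, because the total mass of the discrete measures
    does not depend on the discretization. Both this and the equality of the
    two total masses use that the cells fill the domain up to the bisectors of
    the generators, which are null sets ([carrier_cell_negligible]).

    Gronwall's inequality is needed for absolutely continuous curves that
    satisfy their differential inequality almost everywhere. It follows from
    the fact that an absolutely continuous function whose derivative is
    nonpositive almost everywhere is nonincreasing
    ([ac_real_nonincreasing]), proved by real induction on the interval. This
    is applied to e^{-A} sqrt(|z|^2 + eta^2) - (integral of e^{-A} q), where A
    is a primitive of the Lipschitz constant: the smoothed norm is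
    differentiable wherever z is, and eta tends to 0.

    Bounded domains and tori are treated together through the group of periods
    of the domain, which is trivial in the first case. On the torus the distance
    is attained at some lattice vector ([lattice_nearest]); trajectories are
    lifted to the plane, and the lift of the generator is translated by the
    period that realizes the distance at time 0.

    Measurability in time takes some care. The function s |-> v(s, x(s)) is a
    limit of functions that freeze x on a fine time grid
    ([measurable_along]). The displacement of the centroid, multiplied by alpha,
    enters through a Borel version: almost everywhere it is the difference of
    the velocity of the generator and of the forcing ([displacement_version]).
    This version is compared with the displacement itself under the integral
    sign, as the integral of a nonnegative function is a supremum over the
    simple functions below it, hence monotone without any measurability
    ([ae_ge0_le_integral_lower]). *)

Set Implicit Arguments.
Unset Strict Implicit.
Unset Printing Implicit Defensive.

(** * The Euclidean norm of the plane *)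

Section PlaneCoordinates.
Context {R : realType}.
Implicit Types (x y : plane R).

Lemma plane_eq x y : x.1 = y.1 :> R -> x.2 = y.2 :> R -> x = y.
Proof. by case: x y => [a b] [c d] /= -> ->. Qed.

Lemma fst_comb (a b : R) x y :
  (a *: x + b *: y).1 = a * (x.1 : R) + b * (y.1 : R) :> R.
Proof. by []. Qed.

Lemma snd_comb (a b : R) x y :
  (a *: x + b *: y).2 = a * (x.2 : R) + b * (y.2 : R) :> R.
Proof. by []. Qed.

End PlaneCoordinates.

Section Enorm.
Context {R : realType}.
Implicit Types (x y : plane R) (k : R).

Lemma enorm_ge0 x : 0 <= enorm x. Proof. exact: sqrtr_ge0. Qed.

Lemma sqr_enorm x : enorm x ^+ 2 = (x.1 : R) ^+ 2 + (x.2 : R) ^+ 2.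
Proof. by rewrite sqr_sqrtr// addr_ge0// sqr_ge0. Qed.

Lemma enorm0 : enorm (0 : plane R) = 0.
Proof. by rewrite /enorm /= expr0n /= addr0 sqrtr0. Qed.

Lemma enormN x : enorm (- x) = enorm x.
Proof. by rewrite /enorm /= !sqrrN. Qed.

Lemma enormBC x y : enorm (x - y) = enorm (y - x).
Proof. by rewrite -enormN opprB. Qed.

Lemma enormZ k x : enorm (k *: x) = `|k| * enorm x.
Proof.
by rewrite /enorm /= !exprMn -mulrDr sqrtrM ?sqr_ge0// sqrtr_sqr.
Qed.

Lemma enorm0_eq0 x : enorm x = 0 -> x = 0.
Proof.
move=> x0; have := sqr_enorm x; rewrite x0 expr0n /=.
case: x {x0} => a b /= /esym/eqP.
rewrite paddr_eq0 ?sqr_ge0// !sqrf_eq0 => /andP[/eqP a0 /eqP b0].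
by rewrite [a]a0 [b]b0.
Qed.

Lemma dot_le_enorm x y : dot x y <= enorm x * enorm y.
Proof.
apply: le_trans (ler_norm _) _.
rewrite -(@ler_pXn2r _ 2)// ?nnegrE ?mulr_ge0 ?enorm_ge0//.
rewrite exprMn !sqr_enorm real_normK ?num_real// /dot.
move: x y => [a b] [c d] /=.
have := sqr_ge0 ((a : R) * d - (b : R) * c).
move: (a : R) (b : R) (c : R) (d : R) => {}a {}b {}c {}d; nra.
Qed.

Lemma ler_enormD x y : enorm (x + y) <= enorm x + enorm y.
Proof.
rewrite -(@ler_pXn2r _ 2)// ?nnegrE ?addr_ge0 ?enorm_ge0//.
rewrite sqrrD !sqr_enorm /= .
have := dot_le_enorm x y; rewrite /dot.
move: (enorm x) (enorm y) => p q.
move: x y => [a b] [c d] /=.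
move: (a : R) (b : R) (c : R) (d : R) => {}a {}b {}c {}d; nra.
Qed.

Lemma ler_enormB x y z : enorm (x - z) <= enorm (x - y) + enorm (y - z).
Proof. by rewrite -[x - z](subrKA y) ler_enormD. Qed.

Lemma ler_dist_enorm x y : `|enorm x - enorm y| <= enorm (x - y).
Proof.
have h (a b : plane R) : enorm a - enorm b <= enorm (a - b).
  by rewrite lerBlDr -{1}[a](subrK b) ler_enormD.
by rewrite ler_norml h andbT lerNl opprB enormBC h.
Qed.

Lemma normr_fst_le_enorm x : `|x.1 : R| <= enorm x.
Proof.
by rewrite /enorm -sqrtr_sqr ler_wsqrtr// lerDl sqr_ge0.
Qed.

Lemma normr_snd_le_enorm x : `|x.2 : R| <= enorm x.
Proof.
by rewrite /enorm -sqrtr_sqr ler_wsqrtr// lerDr sqr_ge0.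
Qed.

Lemma enorm_le_norm1 x : enorm x <= `|x.1 : R| + `|x.2 : R|.
Proof.
rewrite -(@ler_pXn2r _ 2)// ?nnegrE ?addr_ge0 ?enorm_ge0//.
rewrite sqr_enorm sqrrD !real_normK ?num_real// lerD2r lerDl.
by rewrite mulrn_wge0// mulr_ge0.
Qed.

(** Smooth approximation of [enorm] from above, which removes the singularity
    at the origin. *)
Definition snorm (eta : R) x : R := Num.sqrt (x.1 ^+ 2 + x.2 ^+ 2 + eta ^+ 2).

Lemma sqr_snorm eta x : snorm eta x ^+ 2 = enorm x ^+ 2 + eta ^+ 2.
Proof. by rewrite sqr_sqrtr ?sqr_enorm// !addr_ge0// sqr_ge0. Qed.

Lemma snorm_gt0 eta x : 0 < eta -> 0 < snorm eta x.
Proof.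
by move=> e0; rewrite sqrtr_gt0 ltr_wpDl ?addr_ge0 ?sqr_ge0// exprn_gt0.
Qed.

Lemma enorm_le_snorm eta x : enorm x <= snorm eta x.
Proof. by rewrite ler_wsqrtr// lerDl sqr_ge0. Qed.

Lemma snorm_le eta x : 0 <= eta -> snorm eta x <= enorm x + eta.
Proof.
move=> e0; have s0 : 0 <= snorm eta x by exact: sqrtr_ge0.
rewrite -(@ler_pXn2r _ 2)// ?nnegrE ?addr_ge0 ?enorm_ge0//.
by rewrite sqr_snorm sqrrD lerD2r lerDl mulrn_wge0// mulr_ge0// enorm_ge0.
Qed.

Lemma snorm_lip eta x y : 0 < eta ->
  `|snorm eta x - snorm eta y| <= enorm (x - y).
Proof.
move=> e0; apply: le_trans (ler_dist_enorm x y).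
have := sqr_snorm eta x; have := sqr_snorm eta y.
have := snorm_gt0 x e0; have := snorm_gt0 y e0.
have := enorm_le_snorm eta x; have := enorm_le_snorm eta y.
have := enorm_ge0 x; have := enorm_ge0 y.
move: (enorm x) (enorm y) (snorm eta x) (snorm eta y) => a b r s.
move=> b0 a0 bs ar s0 r0 sE rE.
rewrite -(@ler_pM2r _ (r + s)) ?addr_gt0//.
have {1}<- : `|r + s| = r + s by rewrite gtr0_norm// addr_gt0.
rewrite -normrM -subr_sqr rE sE opprD addrACA subrr addr0 subr_sqr normrM.
by rewrite ler_wpM2l// ger0_norm ?addr_ge0// lerD.
Qed.

End Enorm.

(** * Absolutely continuous functions *)

(** The scalar counterpart of [absolutely_continuous_on], for the functions
    compared in Gronwall's inequality. *)
Definition ac_real {R : realType} (a b : R) (f : R -> R) :=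
  forall e : R, 0 < e -> exists2 d : R, 0 < d &
  forall (n : nat) (l u : 'I_n -> R),
    (forall i, a <= l i /\ l i <= u i /\ u i <= b) ->
    trivIset setT (fun i => `]l i, u i[%classic) ->
    \sum_(i < n) (u i - l i) < d ->
    \sum_(i < n) `|f (u i) - f (l i)| < e.

Lemma sum_length_le_measure {R : realType} (n : nat) (l u : 'I_n -> R)
    (U : set R) :
  (forall i, l i <= u i) -> trivIset setT (fun i => `]l i, u i[%classic) ->
  open U -> (forall i, `]l i, u i[ `<=` U) ->
  ((\sum_(i < n) (u i - l i))%:E <= leb1 R U)%E.
Proof.
move=> lu tI oU sub.
have -> : (\sum_(i < n) (u i - l i))%:E =
          leb1 R (\big[setU/set0]_(i < n) `]l i, u i[%classic).
  rewrite (measure_bigsetU_ord (leb1 R) predT _ tI); last first.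
    by move=> i; exact: measurable_itv.
  rewrite -sumEFin; apply: eq_bigr => i _.
  rewrite [RHS]lebesgue_measure_itv /= lte_fin.
  by case: ltgtP (lu i) => // ->; rewrite subrr.
apply: le_measure; rewrite ?inE.
- by apply: bigsetU_measurable => i _; exact: measurable_itv.
- exact: open_measurable.
- by apply: (big_ind (fun A => A `<=` U)) => // A B AO BO x [/AO|/BO].
Qed.

(** In the real induction below, both ends of an interval around s are compared
    with s, and either of them may coincide with s. *)
Lemma is_derive_little_o {R : realType} (h : R -> R) (s l e : R) :
  is_derive s (1 : R) h l -> 0 < e ->
  exists2 r : R, 0 < r &
    forall k, `|k| < r -> `|h (s + k) - h s - l * k| <= e * `|k|.
Proof.
move=> [dh dhl] e0.
have : (fun k : R => k^-1 *: (h (k *: 1 + s) - h s)) @ 0^' --> l.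
  by rewrite -dhl.
move=> /cvgrPdist_lt/(_ e e0)[r /= r0 hr]; exists r => // k kr.
have [->|k0] := eqVneq k 0.
  by rewrite addr0 subrr mulr0 subrr normr0 mulr0.
have := hr k; rewrite /= sub0r normrN => /(_ kr k0).
rewrite /GRing.scale /= mulr1 (addrC k s) => /ltW hk.
have -> : h (s + k) - h s - l * k = - (l - k^-1 * (h (s + k) - h s)) * k.
  by field.
by rewrite normrM normrN ler_wpM2r.
Qed.

(** Cover the null set where the derivative is not known to be nonpositive
    by an open set U so small that absolute continuity bounds the increments of
    h over disjoint intervals inside U by e / 2. Near a point of U an interval
    is paid for by this budget; near any other point, h grows with slope at most
    eps. Real induction propagates the resulting bound from a to b. *)
Lemma ac_real_nonincreasing {R : realType} (a b : R) (h : R -> R) :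
  a <= b -> ac_real a b h ->
  {ae leb1 R, forall t, a < t < b ->
     exists2 l : R, l <= 0 & is_derive t (1 : R) h l} ->
  h b <= h a.
Proof.
move=> ab ach [E0 [mE0 E00 subE0]].
(* The end points join the exceptional set, as nothing is assumed on the
   derivative there. *)
pose E := E0 `|` ([set a] `|` [set b]).
have mab : measurable ([set a] `|` [set b] : set (measurableTypeR R)).
  by apply: measurableU; exact: measurable_set1.
have mE : measurable (E : set (measurableTypeR R)) by exact: measurableU.
have E_0 : leb1 R E = 0%E.
  have ab0 : leb1 R ([set a] `|` [set b]) = 0%E.
    rewrite measureU0; [|exact: measurable_set1|exact: measurable_set1|].
      exact: lebesgue_measure_set1.
    exact: lebesgue_measure_set1.
  by rewrite /E measureU0.
apply/ler_addgt0Pr => e e0.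
have /ach[d d0 hd] : 0 < e / 2 by rewrite divr_gt0.
have [|U [oU EU Ud]] := lebesgue_regularity_outer mE _ d0.
  by rewrite [X in (X < _)%E]E_0.
have {}Ud : (leb1 R U < d%:E)%E.
  apply: le_lt_trans Ud; rewrite -[X in leb1 R X](setDUK EU).
  apply: le_trans.
    apply: measureU2 => //; apply: measurableD => //.
    exact: open_measurable.
  by rewrite [X in (X + _)%E]E_0 add0e.
(* The slopes then contribute at most e / 2 over [a, b]; the summand 1 avoids
   dividing by zero. *)
pose eps := e / 2 / (b - a + 1).
have ba1 : 0 < b - a + 1 by lra.
have eps0 : 0 < eps by rewrite !divr_gt0.
(* The intervals l i, u i form the part of the budget spent so far. They are
   listed from left to right, so that a new one is simply appended. *)
pose Fam x := exists n (l u : nat -> R),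
  [/\ forall i, (i < n)%N -> [/\ a <= l i, l i <= u i & u i <= x],
      forall i, (i < n)%N -> `]l i, u i[ `<=` U,
      forall i j, (i < j < n)%N -> u i <= l j &
      h x - h a <= eps * (x - a) + \sum_(i < n) `|h (u i) - h (l i)|].
have local s : a <= s <= b -> exists2 r : R, 0 < r &
    forall x y, a <= x -> x <= s -> s <= y -> y <= b -> s - r < x -> y < s + r ->
    h y - h x <= eps * (y - x) \/ `]x, y[ `<=` U.
  move=> /andP[as_ sb]; have [Es|nEs] := pselect (E s).
    have /(nbhs_ballP s U)[r /= r0 rU] : nbhs s U.
      by apply: open_nbhs_nbhs; split => //; exact: EU.
    exists r => // x y ax xs sy yb rx yr; right => z /=.
    rewrite in_itv/= => /andP[xz zy]; apply: rU => /=.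
    by rewrite /ball/= ltr_norml; lra.
  have asb : a < s < b.
    rewrite !lt_neqAle as_ sb !andbT; apply/andP; split.
      by apply/eqP => as'; apply: nEs; right; left.
    by apply/eqP => as'; apply: nEs; right; right.
  have [l l0 /is_derive_little_o/(_ eps0)[r r0 hr]] :
      exists2 l : R, l <= 0 & is_derive s (1 : R) h l.
    have [//|nP] := pselect (exists2 l : R, l <= 0 & is_derive s (1 : R) h l).
    by exfalso; apply: nEs; left; apply: subE0 => /= /(_ asb).
  exists r => // x y ax xs sy yb rx yr; left.
  have := hr (y - s); rewrite ger0_norm ?subr_ge0// addrCA subrr addr0.
  move=> /(_ ltac:(lra)); rewrite ler_norml => /andP[_ h1].
  have := hr (x - s); rewrite ler0_norm ?subr_le0// addrCA subrr addr0.
  move=> /(_ ltac:(lra)); rewrite ler_norml => /andP[h2 _].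
  have := mulr_le0_ge0 l0 (_ : 0 <= y - s); have := mulr_le0_ge0 l0 (_ : 0 <= s - x).
  move=> /(_ ltac:(lra)) + /(_ ltac:(lra)).
  by move: h1 h2; rewrite !mulrBr; lra.
have step x y : a <= x -> x <= y ->
    h y - h x <= eps * (y - x) \/ `]x, y[ `<=` U -> Fam x -> Fam y.
  move=> ax xy [hxy|xyU] [n [l [u [lu luU dis hx]]]].
    exists n, l, u; split => //.
      by move=> i /lu[? ? ?]; split => //; exact: le_trans xy.
    by move: hx hxy; rewrite !mulrBr; lra.
  exists n.+1, (fun i => if (i < n)%N then l i else x),
    (fun i => if (i < n)%N then u i else y); split.
  - by move=> i _; case: ifPn => [/lu[? ? ?]|_]; split => //; exact: le_trans xy.
  - by move=> i _; case: ifPn => [/luU|_].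
  - move=> i j /andP[ij]; rewrite ltnS => jn.
    rewrite (leq_trans ij jn); case: ifPn => jn'; first by apply: dis; rewrite ij.
    by have [] := lu _ (leq_trans ij jn).
  - rewrite big_ord_recr /= ltnn.
    under eq_bigr => i _ do rewrite ltn_ord.
    have := ler_norm (h y - h x); have : 0 <= eps * (y - x).
      by rewrite mulr_ge0 ?subr_ge0 ?(ltW eps0).
    by move: hx; rewrite !mulrBr; lra.
pose S := [set x | a <= x <= b /\ Fam x].
have Sa : S a.
  split; first by rewrite lexx.
  exists 0%N, (fun=> a), (fun=> a); split => //.
  by rewrite big_ord0 !subrr mulr0 addr0.
have supS : has_sup S.
  by split; [exists a|exists b => x [/andP[]]].
have sab : a <= sup S <= b.
  apply/andP; split; first exact: (ub_le_sup supS.2).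
  by apply: (ge_sup supS.1) => x [/andP[]].
(* An interval around sup S leads from a point of S to a point beyond sup S,
   unless sup S = b. *)
have [r r0 hr] := local _ sab.
have [x [/andP[ax xb] Fx] sx] := sup_adherent r0 supS.
have xs : x <= sup S by apply: (ub_le_sup supS.2); split => //; rewrite ax.
pose y := Num.min b (sup S + r / 2).
have sy : sup S <= y by rewrite le_min (andP sab).2/=; lra.
have yb : y <= b by rewrite ge_min lexx.
have yr : y < sup S + r by rewrite gt_min; apply/orP; right; lra.
have Fy : Fam y by apply: (step x) => //; [exact: le_trans sy|exact: hr].
have ys : y <= sup S.
  by apply: (ub_le_sup supS.2); split => //; rewrite yb (le_trans _ sy)// (andP sab).1.
have yE : y = b by move: ys; rewrite /y; case: (leP b) => // *; lra.
move: Fy; rewrite yE => -[n [l [u [lu luU dis hx]]]].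
have tI : trivIset setT (fun i : 'I_n => `]l i, u i[%classic).
  apply/trivIsetP => i j _ _ ij; apply/seteqP; split => // z /=.
  rewrite !in_itv/= => -[/andP[z1 z2] /andP[z3 z4]].
  have [ij'|ij'|ij'] := ltngtP i j.
  - by have := dis i j; rewrite ij' ltn_ord => /(_ isT); lra.
  - by have := dis j i; rewrite ij' ltn_ord => /(_ isT); lra.
  - by move/eqP : ij; apply; exact: val_inj.
have := hd n (fun i => l i) (fun i => u i) _ tI _.
have lu' (i : 'I_n) : a <= l i /\ l i <= u i /\ u i <= b.
  by have [] := lu _ (ltn_ord i).
move=> /(_ lu') lt; have {lt} : \sum_(i < n) `|h (u i) - h (l i)| < e / 2.
  apply: lt; rewrite -lte_fin; apply: le_lt_trans Ud.
  apply: sum_length_le_measure => // i; first by have [_ []] := lu' i.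
  exact: luU.
have : eps * (b - a) <= e / 2.
  rewrite /eps mulrAC ler_pdivrMr// ler_pM2l ?divr_gt0//; lra.
by move: hx; lra.
Qed.

Section AbsoluteContinuity.
Context {R : realType}.

(** Absolute continuity of composite expressions: it suffices to bound
    increments by those of absolutely continuous functions. *)
Lemma ac_dominated (a b K : R) (h A G : R -> R) (z : R -> plane R) :
  0 <= K -> ac_real a b A -> ac_real a b G -> absolutely_continuous_on a b z ->
  (forall l u, a <= l -> l <= u -> u <= b ->
     `|h u - h l| <= K * `|A u - A l| + enorm (z u - z l) + `|G u - G l|) ->
  ac_real a b h.
Proof.
move=> K0 acA acG acz hd e e0.
have K1 : 0 < K + 1 by lra.
have [|dA dA0 hA] := acA (e / 3 / (K + 1)); first by rewrite !divr_gt0.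
have [|dG dG0 hG] := acG (e / 3); first by rewrite !divr_gt0.
have [|dz dz0 hz] := acz (e / 3); first by rewrite !divr_gt0.
exists (Num.min dA (Num.min dG dz)); first by rewrite !lt_min dA0 dG0.
move=> n l u lu tI; rewrite !lt_min => /and3P[lA lG lz].
have {}hA := hA n l u lu tI lA.
have {}hG := hG n l u lu tI lG.
have {}hz := hz n l u lu tI lz.
apply: (@le_lt_trans _ _ (K * \sum_(i < n) `|A (u i) - A (l i)| +
   \sum_(i < n) enorm (z (u i) - z (l i)) + \sum_(i < n) `|G (u i) - G (l i)|)).
  rewrite mulr_sumr -!big_split/=; apply: ler_sum => i _.
  by have [? [? ?]] := lu i; exact: hd.
have : K * \sum_(i < n) `|A (u i) - A (l i)| <= e / 3.
  apply: (@le_trans _ _ (K * (e / 3 / (K + 1)))).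
    by rewrite ler_wpM2l// ltW.
  rewrite mulrA ler_pdivrMr// mulrDr mulr1 (mulrC K) lerDl.
  by rewrite divr_ge0// ltW.
by move: hG hz; lra.
Qed.

Lemma absolutely_continuous_onS (a b c d : R) (z : R -> plane R) :
  a <= c -> d <= b -> absolutely_continuous_on a b z ->
  absolutely_continuous_on c d z.
Proof.
move=> ac db acz e /acz[r r0 hr]; exists r => // n l u lu.
by apply: hr => i; have [? [? ?]] := lu i; split; [|split]; lra.
Qed.

Lemma ac_unif_continuous (a b e : R) (x : R -> plane R) : absolutely_continuous_on a b x -> 0 < e ->
  exists2 d : R, 0 < d & forall s t, a <= s <= b -> a <= t <= b -> `|s - t| < d ->
    enorm (x s - x t) < e.
Proof.
move=> acx /acx[d d0 hd]; exists d => // .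
have h l u : a <= l -> l <= u -> u <= b -> u - l < d -> enorm (x u - x l) < e.
  move=> al lu ub uld.
  have := hd 1%N (fun=> l) (fun=> u); rewrite !big_ord1 => /(_ _ _ uld); apply => //.
  by move=> i j _ _ _; rewrite !ord1.
move=> s t /andP[as_ sb] /andP[at_ tb].
have [st|/ltW ts] := leP s t.
  by rewrite distrC ger0_norm ?subr_ge0// enormBC; exact: h.
by rewrite ger0_norm ?subr_ge0//; exact: h.
Qed.

(** Absolute continuity bounds the increment over every interval shorter
    than some d by 1, and finitely many such intervals cover [a, b]. *)
Lemma ac_bounded (a b : R) (z : R -> plane R) : a <= b ->
  absolutely_continuous_on a b z ->
  exists2 K : R, 0 <= K & forall t, a <= t <= b -> enorm (z t) <= K.
Proof.
move=> ab /(_ 1 ltr01)[d d0 hd].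
have step l u : a <= l -> l <= u -> u <= b -> u - l < d ->
    enorm (z u) <= enorm (z l) + 1.
  move=> al lu ub uld.
  have := hd 1%N (fun=> l) (fun=> u); rewrite !big_ord1 => /(_ _ _ uld) h.
  have {}h : enorm (z u - z l) < 1.
    by apply: h => // i j _ _ _; rewrite !ord1.
  rewrite -[z u](subrK (z l)) (le_trans (ler_enormD _ _))// addrC lerD2l.
  exact: ltW.
have bnd k : forall t, a <= t <= b -> t - a <= k%:R * (d / 2) ->
    enorm (z t) <= enorm (z a) + k%:R.
  elim: k => [|k IH] t /andP[at_ tb] tk.
    by rewrite mul0r in tk; have -> : t = a; [lra|rewrite addr0].
  have [tk'|tk'] := leP (t - a) (k%:R * (d / 2)).
    by apply: le_trans (IH _ _ _) _; rewrite ?at_// lerD2l ler_nat.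
  move: tk; rewrite -natr1 mulrDl mul1r => tk.
  have k0 : 0 <= k%:R * (d / 2) by rewrite mulr_ge0// ltW// divr_gt0.
  have h1 := IH (a + k%:R * (d / 2)) ltac:(lra) ltac:(lra).
  have h2 := step (a + k%:R * (d / 2)) t ltac:(lra) ltac:(lra) tb ltac:(lra).
  by lra.
(* Steps of length d / 2, as increments are controlled for lengths < d only. *)
pose k := (Num.truncn ((b - a) / (d / 2))).+1.
exists (enorm (z a) + k%:R); first by rewrite addr_ge0// enorm_ge0.
move=> t tab; apply: bnd => //.
rewrite -ler_pdivrMr ?divr_gt0//; apply: le_trans (ltW (truncnS_gt _)).
by rewrite ler_pM2r ?invr_gt0 ?divr_gt0// lerD2r (andP tab).2.
Qed.

End AbsoluteContinuity.

Lemma absolutely_continuous_onB {R : realType} (a b : R) (x y : R -> plane R) :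
  absolutely_continuous_on a b x -> absolutely_continuous_on a b y ->
  absolutely_continuous_on a b (fun s => x s - y s).
Proof.
move=> acx acy e e0; have e2 : 0 < e / 2 by rewrite divr_gt0.
have [d d0 hd] := acx _ e2; have [d' d'0 hd'] := acy _ e2.
exists (Num.min d d'); first by rewrite lt_min d0.
move=> n l u lu tI; rewrite lt_min => /andP[lud lud'].
rewrite (splitr e); apply: le_lt_trans (ltrD (hd n l u lu tI lud) (hd' n l u lu tI lud')).
rewrite -big_split/=; apply: ler_sum => i _.
rewrite opprD addrACA -opprD; apply: le_trans (ler_enormD _ _) _.
by rewrite enormN.
Qed.

Lemma absolutely_continuous_onDr {R : realType} (a b : R) (x : R -> plane R) k :
  absolutely_continuous_on a b x ->
  absolutely_continuous_on a b (fun s => x s + k).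
Proof.
move=> acx e /acx[d d0 hd]; exists d => // n l u lu tI lud.
apply: le_lt_trans (hd n l u lu tI lud); apply: ler_sum => i _.
by rewrite opprD addrACA subrr addr0.
Qed.

(** * Indefinite integrals *)

Section Cumulative.
Context {R : realType}.
Implicit Types (g : R -> R).

(** Integrating from -oo rather than from 0 makes this nondecreasing on the
    whole line for g >= 0; it is used for functions supported in ]0, T[. *)
Definition cumul g (t : R) : R := \int[leb1 R]_(s in `]-oo, t]) g s.

Lemma cumulB g (l u : R) : (leb1 R).-integrable setT (EFin \o g) -> l <= u ->
  cumul g u - cumul g l = \int[leb1 R]_(s in `]l, u]) g s.
Proof.
move=> ig lu; by apply: Rintegral_itvB => //; apply: integrableS ig.
Qed.

(** The increments over disjoint intervals add up to at most the integral of
    |g| over their union, which is small when the union has small measure. *)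
Lemma ac_cumul g (a b : R) : (leb1 R).-integrable setT (EFin \o g) ->
  ac_real a b (cumul g).
Proof.
move=> ig e e0; have [d [d0 hd]] := integral_normr_continuous ig e0.
exists d => // n l u lu tI lud.
have lu' i : l i <= u i by have [_ []] := lu i.
pose A := \big[setU/set0]_(i < n) `]l i, u i[%classic.
have mA : measurable (A : set (measurableTypeR R)).
  by apply: bigsetU_measurable => i _; exact: measurable_itv.
have lA : (leb1 R A < d%:E)%E.
  rewrite (measure_bigsetU_ord (leb1 R) predT _ tI); last first.
    by move=> i; exact: measurable_itv.
  rewrite (_ : (\sum_(i < n) _)%E = (\sum_(i < n) (u i - l i))%:E) ?lte_fin//.
  rewrite -sumEFin; apply: eq_bigr => i _.
  rewrite [LHS]lebesgue_measure_itv /= lte_fin.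
  by case: ltgtP (lu' i) => // ->; rewrite subrr.
apply: le_lt_trans (hd _ mA lA).
have mg : measurable_fun setT g by move/integrableP : ig => [/measurable_EFinP].
have iN (B : set (measurableTypeR R)) : measurable B ->
    (leb1 R).-integrable B (fun s => (`|g s|)%:E).
  move=> mB; have igT : (leb1 R).-integrable setT (EFin \o (fun s => `|g s|)).
    exact: integrable_norm.
  exact: integrableS igT.
rewrite -lee_fin /Rintegral fineK; last first.
  by apply: integrable_fin_num => //; exact: iN.
rewrite /A ge0_integral_bigsetU//=; last first.
- apply/measurable_EFinP; apply: measurableT_comp => //.
  exact: measurable_funTS.
- by apply: sub_trivIset tI => x.
- exact: index_enum_uniq.
rewrite -sumEFin; apply: lee_sum => i _.
rewrite cumulB// -Rintegral_itv_bndo_bndc; last exact: integrableS ig.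
apply: (@le_trans _ _ (\int[leb1 R]_(s in `]l i, u i[) `|g s|)%:E).
  by rewrite lee_fin; apply: le_normr_Rintegral => //; exact: integrableS ig.
rewrite /Rintegral fineK//; apply: integrable_fin_num => //; exact: iN.
Qed.

Lemma is_derive_cumul g : (leb1 R).-integrable setT (EFin \o g) ->
  {ae leb1 R, forall t, is_derive t (1 : R) (cumul g) (g t)}.
Proof.
move=> ig; have : locally_integrable setT g.
  have := @integrable_locally R g setT measurableT ig.
  by rewrite patch_setT.
have iy (y : R) : (leb1 R).-integrable `]-oo, y] (EFin \o g).
  by apply: integrableS ig.
move=> loc; refine (@filterS _ _ (ae_filter_ringOfSetsType (leb1 R)) _ _ _
  (FTC1Ny iy loc)) => t [dt Et]; apply: DeriveDef => //.
by rewrite -derive1E.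
Qed.

End Cumulative.

Section CumulRestrict.
Context {R : realType}.

Lemma integrable_restrict_itv (T : R) (f : R -> R) :
  (leb1 R).-integrable `]0, T[ (EFin \o f) ->
  (leb1 R).-integrable setT (EFin \o (f \_ `]0, T[)).
Proof.
move=> h; have /(integrable_mkcond _ _).1 := h => /(_ (measurable_itv _)).
by rewrite restrict_EFin.
Qed.

(** Links the primitive on the whole line of a function cut off outside
    ]0, T[ with the integrals over ]0, t[ of the error estimate. *)
Lemma cumul_restrict (T t : R) (f : R -> R) : t <= T ->
  (leb1 R).-integrable `]0, T[ (EFin \o f) ->
  cumul (f \_ `]0, T[) t = \int[leb1 R]_(s in `]0, t[) f s.
Proof.
move=> tT /integrable_restrict_itv h.
rewrite /cumul -Rintegral_itv_bndo_bndc; last by apply: integrableS h.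
rewrite -Rintegral_mkcondr; congr (Rintegral _ _ _).
apply/seteqP; split => s /=; rewrite !in_itv/=; first by move=> [-> /andP[->]].
by move=> /andP[s0 st]; rewrite s0 st (lt_le_trans st tT).
Qed.

End CumulRestrict.

(** * Gronwall's inequality *)

Section Gronwall.
Context {R : realType}.

Lemma is_derive_snorm (eta t : R) (z : R -> plane R) (p : plane R) :
  0 < eta -> vderive z t p ->
  is_derive t (1 : R) (fun s => snorm eta (z s)) (dot (z t) p / snorm eta (z t)).
Proof.
move=> e0 [d1 d2].
pose z1 s : R := (z s).1; pose z2 s : R := (z s).2.
have dz : is_derive t (1 : R) (z1 * z1 + z2 * z2 + cst (eta ^+ 2))
    (z1 t *: (p.1 : R) + z1 t *: (p.1 : R) + (z2 t *: (p.2 : R) + z2 t *: (p.2 : R)) + 0).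
  have d11 := is_deriveM d1 d1; have d22 := is_deriveM d2 d2.
  exact: is_deriveD (is_deriveD d11 d22) (is_derive_cst _ _ _).
have zE s : (z1 * z1 + z2 * z2 + cst (eta ^+ 2)) s = z1 s ^+ 2 + z2 s ^+ 2 + eta ^+ 2.
  by rewrite !expr2.
have sg0 : 0 < (z1 * z1 + z2 * z2 + cst (eta ^+ 2)) t.
  by rewrite zE ltr_wpDl ?addr_ge0 ?sqr_ge0// exprn_gt0.
have := is_derive1_comp (is_derive1_sqrt sg0) dz.
move=> h; have {}h := is_derive_eq h.
have -> : (fun s => snorm eta (z s)) = Num.sqrt \o (z1 * z1 + z2 * z2 + cst (eta ^+ 2)).
  by apply/funext => s /=; rewrite zE.
apply: h; rewrite zE.
rewrite /GRing.scale/= -[Num.sqrt _]/(snorm eta (z t)).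
have s0 : snorm eta (z t) != 0 by rewrite gt_eqF// snorm_gt0.
rewrite /dot -!/(z1 t) -!/(z2 t).
move: (p.1 : R) (p.2 : R) (z1 t) (z2 t) => p1 p2 u1 u2.
field.
exact: s0.
Qed.

Lemma cumul_ge0 (L : R -> R) (t : R) : (forall s, 0 <= L s) -> 0 <= cumul L t.
Proof. by move=> L0; apply: Rintegral_ge0. Qed.

Lemma ler_cumul (L : R -> R) (s t : R) : (leb1 R).-integrable setT (EFin \o L) ->
  (forall s, 0 <= L s) -> s <= t -> cumul L s <= cumul L t.
Proof.
by move=> iL L0 st; rewrite -subr_ge0 cumulB//; apply: Rintegral_ge0.
Qed.

Lemma measurable_cumul (L : R -> R) : (leb1 R).-integrable setT (EFin \o L) ->
  (forall s, 0 <= L s) -> measurable_fun (setT : set (measurableTypeR R)) (cumul L).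
Proof.
move=> iL L0; apply: nondecreasing_measurable => //.
by move=> s t; exact: ler_cumul.
Qed.

Lemma expRN_cumul_le1 (L : R -> R) t : (forall s, 0 <= L s) ->
  expR (- cumul L t) <= 1.
Proof. by move=> L0; rewrite -expR0 ler_expR oppr_le0 cumul_ge0. Qed.

Lemma integrable_expRN_cumul (L q : R -> R) :
  (leb1 R).-integrable setT (EFin \o L) -> (forall s, 0 <= L s) ->
  (leb1 R).-integrable setT (EFin \o q) ->
  (leb1 R).-integrable setT (EFin \o (fun s => expR (- cumul L s) * q s)).
Proof.
move=> iL L0 iq; apply: le_integrable (iq) => //.
  apply/measurable_EFinP; apply: measurable_funM.
    apply: measurableT_comp => //; apply: measurableT_comp => //.
    exact: measurable_cumul.
  by move/integrableP : (iq) => [/measurable_EFinP].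
move=> s _ /=; rewrite lee_fin normrM ger0_norm ?expR_ge0//.
by rewrite ler_piMl// expRN_cumul_le1.
Qed.

(** With A the primitive of L, the function
    h = e^{-A} snorm eta z - (primitive of e^{-A} q) is absolutely continuous and
    h' <= e^{-A} (L |z|^2 / snorm + q |z| / snorm - L snorm - q) <= 0 almost
    everywhere, since |z| <= snorm. Hence h is nonincreasing; then eta -> 0. *)
Lemma gronwall (b : R) (L q : R -> R) (z : R -> plane R) : 0 <= b ->
  (leb1 R).-integrable setT (EFin \o L) -> (forall s, 0 <= L s) ->
  (leb1 R).-integrable setT (EFin \o q) -> (forall s, 0 <= q s) ->
  absolutely_continuous_on 0 b z ->
  {ae leb1 R, forall t, 0 < t < b ->
     exists2 p, vderive z t p & enorm p <= L t * enorm (z t) + q t} ->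
  expR (- cumul L b) * enorm (z b) <= expR (- cumul L 0) * enorm (z 0) +
     \int[leb1 R]_(s in `]0, b]) (expR (- cumul L s) * q s).
Proof.
move=> b0 iL L0 iq q0 acz dz.
set Q := fun s => expR (- cumul L s) * q s.
have iQ : (leb1 R).-integrable setT (EFin \o Q) by exact: integrable_expRN_cumul.
rewrite -(cumulB iQ b0).
have [K K0 zK] := ac_bounded b0 acz.
apply/ler_addgt0Pr => eta eta0.
pose h t := expR (- cumul L t) * snorm eta (z t) - cumul Q t.
suff hb : h b <= h 0.
  (* Kept abstract: the terms substituted for these variables are costly to
     compare. *)
  have combine (p p' r r' u k x : R) : p - p' <= r - r' -> u <= p ->
      r <= k * (x + eta) -> k * eta <= 1 * eta -> u <= k * x + (p' - r') + eta.
    by move=> *; lra.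
  apply: combine hb _ _ _.
  - exact: (ler_wpM2l (expR_ge0 _) (enorm_le_snorm eta (z b))).
  - exact: (ler_wpM2l (expR_ge0 _) (snorm_le (z 0) (ltW eta0))).
  - exact: (ler_wpM2r (ltW eta0) (expRN_cumul_le1 0 L0)).
apply: (ac_real_nonincreasing b0).
  apply: (@ac_dominated _ _ _ (K + eta) h (cumul L) (cumul Q) z).
  - by rewrite addr_ge0// ltW.
  - exact: ac_cumul.
  - exact: ac_cumul.
  - by [].
  - move=> l u l0 lu ub.
    have hE : h u - h l = (expR (- cumul L u) - expR (- cumul L l)) * snorm eta (z u)
       + expR (- cumul L l) * (snorm eta (z u) - snorm eta (z l))
       - (cumul Q u - cumul Q l).
      rewrite /h; clear.
      move: (expR (- cumul L u)) (expR (- cumul L l)) (snorm eta (z u))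
        (snorm eta (z l)) (cumul Q u) (cumul Q l) => c1 c2 c3 c4 c5 c6; ring.
    rewrite hE; apply: (le_trans (ler_normB _ _)); rewrite lerD2r.
    apply: (le_trans (ler_normD _ _)); apply: lerD.
      rewrite normrM mulrC; apply: ler_pM => //.
        rewrite ger0_norm ?(ltW (snorm_gt0 _ eta0))//.
        apply: le_trans (snorm_le _ (ltW eta0)) _; rewrite lerD2r zK//.
        by rewrite (le_trans l0 lu).
      have lLu := ler_cumul iL L0 lu.
      rewrite distrC !ger0_norm ?subr_ge0 ?ler_expR ?lerN2//.
      have -> : - cumul L u = - cumul L l + - (cumul L u - cumul L l) by ring.
      rewrite expRD -{1}[expR (- cumul L l)]mulr1 -mulrBr.
      have h1 := expR_ge1Dx (- (cumul L u - cumul L l)).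
      have h2 : expR (- (cumul L u - cumul L l)) <= 1.
        by rewrite -expR0 ler_expR oppr_le0 subr_ge0.
      have := ler_wpM2r (_ : 0 <= 1 - expR (- (cumul L u - cumul L l))) (expRN_cumul_le1 l L0).
      rewrite subr_ge0 => /(_ h2); move: h1 h2; clear.
      move: (expR (- cumul L l)) (expR (- (cumul L u - cumul L l)))
        (cumul L u - cumul L l) => E e d; lra.
    rewrite normrM ger0_norm ?expR_ge0//.
    rewrite -[leRHS]mul1r ler_pM ?expR_ge0 ?expRN_cumul_le1//.
    exact: snorm_lip.
refine (@filterS3 _ _ (ae_filter_ringOfSetsType (leb1 R)) _ _ _ _ _
  (is_derive_cumul iL) (is_derive_cumul iQ) dz) => t dL dQ dzt tb.
have [p dp ple] := dzt tb.
have := is_deriveB (is_deriveM (is_derive1_comp (is_derive_expR _) (is_deriveN dL))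
   (is_derive_snorm eta0 dp)) dQ.
move=> dh; eexists; last exact: dh.
rewrite /GRing.scale /= /Q.
have s0 := snorm_gt0 (z t) eta0.
set r := snorm eta (z t) in s0 *.
set E := expR _.
have E0 : 0 <= E by exact: expR_ge0.
have -> : E * (dot (z t) p / r) + r * (E * - L t) - E * q t =
   E * (dot (z t) p / r - r * L t - q t) by ring.
rewrite mulr_ge0_le0// -(ler_pM2r s0) mul0r.
have -> : (dot (z t) p / r - r * L t - q t) * r = dot (z t) p - r * r * L t - r * q t.
  by field; rewrite gt_eqF.
have ez := enorm_le_snorm eta (z t); rewrite -/r in ez.
have z0 := enorm_ge0 (z t).
have h1 := dot_le_enorm (z t) p.
have h2 := ler_wpM2l z0 ple.
have h3 : enorm (z t) * (L t * enorm (z t) + q t) <= r * (L t * r + q t).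
  apply: ler_pM => //; first by rewrite addr_ge0// mulr_ge0.
  by rewrite lerD2r ler_wpM2l.
lra.
Qed.

End Gronwall.

(** * Borel sets and Lebesgue measure of the plane *)

Section PlaneTopology.
Context {R : realType}.
Implicit Types (A S : set (plane R)) (x y : plane R).

(** The topology of the plane comes from the sup norm of the product; it is
    the same for the Euclidean norm. *)
Lemma open_enormP A : open A <->
  forall x, A x -> exists2 r : R, 0 < r & forall y, enorm (y - x) < r -> A y.
Proof.
split=> [oA x Ax|h].
  have /(nbhs_ballP x A)[r /= r0 rA] : nbhs x A by exact: open_nbhs_nbhs.
  exists r => // y yx; apply: rA; split; rewrite /ball /= distrC.
    exact: le_lt_trans (normr_fst_le_enorm (y - x)) yx.
  exact: le_lt_trans (normr_snd_le_enorm (y - x)) yx.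
rewrite openE => x /h[r r0 hr]; apply/nbhs_ballP; exists (r / 2).
  by rewrite /= divr_gt0.
move=> y [y1 y2]; apply: hr; apply: le_lt_trans (enorm_le_norm1 _) _.
rewrite /ball /= in y1 y2.
by rewrite (splitr r) ltrD//= distrC.
Qed.

Lemma open_lt_lipschitz (f : plane R -> R) (C c : R) : 0 <= C ->
  (forall x y, `|f x - f y| <= C * enorm (x - y)) -> open [set x | f x < c].
Proof.
move=> C0 fC; apply/open_enormP => x /= fx.
have C1 : 0 < C + 1 by lra.
exists ((c - f x) / (C + 1)); first by rewrite divr_gt0// subr_gt0.
move=> y; rewrite ltr_pdivlMr// => yx.
have := ler_norm (f y - f x); have := fC y x.
have := enorm_ge0 (y - x); nra.
Qed.

(** An open set is a countable union of open boxes with rational centres and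
    half-sides, and boxes are measurable for the product sigma-algebra. *)
Lemma plane_open_measurable A : open A -> measurable A.
Proof.
move=> /open_enormP oA.
pose box (q : rat * rat * rat) : set (plane R) :=
  `](ratr q.1.1 - ratr q.2 : R), ratr q.1.1 + ratr q.2[%classic `*`
  `](ratr q.1.2 - ratr q.2 : R), ratr q.1.2 + ratr q.2[%classic.
have -> : A = \bigcup_q (if `[< box q `<=` A >] then box q else set0).
  apply/seteqP; split => [x /oA[r r0 hr]|x [q _]]; last first.
    by case: asboolP => // qA; exact: qA.
  have [e] : exists q : rat, ratr q \in `]0%R, (r / 4)[.
    by apply: rat_in_itvoo; rewrite divr_gt0.
  rewrite in_itv/= => /andP[e0 er].
  have rat_near (u : R) : exists q : rat, `|u - ratr q| < ratr e.
    have [q] : exists q : rat, ratr q \in `](u - ratr e), (u + ratr e)[.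
      by apply: rat_in_itvoo; lra.
    by rewrite in_itv/= => /andP[? ?]; exists q; rewrite ltr_norml; lra.
  have [q1 hq1] := rat_near x.1; have [q2 hq2] := rat_near x.2.
  exists (q1, q2, e) => //; rewrite asboolT.
    move: hq1 hq2; rewrite !ltr_norml => /andP[a1 a2] /andP[b1 b2].
    split; rewrite /= in_itv/=; lra.
  move=> y [/=]; rewrite !in_itv/= => /andP[y1 y2] /andP[y3 y4].
  apply: hr; apply: le_lt_trans (enorm_le_norm1 _) _ => /=.
  have h1 : `|(y.1 : R) - x.1| < r / 2.
    by move: hq1; rewrite !ltr_norml => /andP[a1 a2]; lra.
  have h2 : `|(y.2 : R) - x.2| < r / 2.
    by move: hq2; rewrite !ltr_norml => /andP[a1 a2]; lra.
  rewrite (splitr r); exact: ltrD.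
apply: countable_bigcupT_measurable => // q.
by case: asboolP => // _; apply: measurableX; exact: measurable_itv.
Qed.

(** A Lipschitz function on S is the supremum of the cones
    x |-> f y - C |x - y|, y in S, so each superlevel set is the trace on S of an
    open set. *)
Lemma lipschitz_measurable_fun S (f : plane R -> R) (C : R) : 0 <= C ->
  measurable S -> (forall x y, S x -> S y -> `|f x - f y| <= C * enorm (x - y)) ->
  measurable_fun S (f : plane R -> measurableTypeR R).
Proof.
move=> C0 mS fC.
apply: (measurability (@RGenOInfty.G R)) => [|/= _ [_] [c] -> <-].
  exact: RGenOInfty.measurableE.
pose U y : set (plane R) := [set x | c < f y - C * enorm (x - y)].
have -> : S `&` f @^-1` `]c, +oo[ = S `&` \bigcup_(y in S) U y.
  apply/seteqP; split => x [Sx] /=.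
    rewrite in_itv/= andbT => cf; split => //; exists x => //=.
    by rewrite /U /= subrr enorm0 mulr0 subr0.
  move=> [y Sy]; rewrite /U /= => cU; split => //=; rewrite in_itv/= andbT.
  have := fC _ _ Sx Sy; rewrite ler_norml => /andP[h _]; lra.
apply: measurableI => //; apply: plane_open_measurable.
apply: bigcup_open => y _.
rewrite (_ : U y = [set x | C * enorm (x - y) < f y - c]).
  apply: (@open_lt_lipschitz _ C) => // x z.
  rewrite -mulrBr normrM ger0_norm// ler_wpM2l//.
  apply: le_trans (ler_dist_enorm _ _) _.
  by rewrite opprB addrA subrK.
by apply/seteqP; split => x; rewrite /U /=; lra.
Qed.

(** Pairing on a measurable subset, from pairing on the whole space after
    extending both functions by a default value. *)
Lemma measurable_fun_pair_on d (T : measurableType d) (E : set T)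
    (f g : T -> measurableTypeR R) : measurable E ->
  measurable_fun E f -> measurable_fun E g ->
  measurable_fun E (fun t => (f t, g t)).
Proof.
move=> mE mf mg.
apply: (eq_measurable_fun (fun t => ((f \_ E) t, (g \_ E) t))).
  by move=> t tE; rewrite /patch tE.
apply: measurable_funTS; apply: measurable_fun_pair.
  exact: (measurable_restrictT f mE).1.
exact: (measurable_restrictT g mE).1.
Qed.

Lemma lipschitz_measurable_fun_plane S (f : plane R -> plane R) (C : R) : 0 <= C ->
  measurable S ->
  (forall x y, S x -> S y -> enorm (f x - f y) <= C * enorm (x - y)) ->
  measurable_fun S f.
Proof.
move=> C0 mS fC.
have m1 : measurable_fun S (fun x => (f x).1).
  apply: (@lipschitz_measurable_fun _ _ C) => // x y Sx Sy.
  exact: le_trans (normr_fst_le_enorm (f x - f y)) (fC _ _ Sx Sy).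
have m2 : measurable_fun S (fun x => (f x).2).
  apply: (@lipschitz_measurable_fun _ _ C) => // x y Sx Sy.
  exact: le_trans (normr_snd_le_enorm (f x - f y)) (fC _ _ Sx Sy).
apply: (eq_measurable_fun (fun x => ((f x).1, (f x).2))); last exact: measurable_fun_pair_on.
  by move=> x _; rewrite -surjective_pairing.
Qed.

(** If b = 0 the line is a product with a null first factor; otherwise each of
    its vertical sections is a point. *)
Lemma leb2_line (a b c : R) : a != 0 \/ b != 0 ->
  leb2 R [set x : plane R | a * (x.1 : R) + b * (x.2 : R) = c] = 0%E.
Proof.
move=> ab; have [b0|b0] := eqVneq b 0.
  have a0 : a != 0 by case: ab => //; rewrite b0 eqxx.
  rewrite (_ : [set _ | _] = [set (c / a : measurableTypeR R)] `*` setT).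
    rewrite [LHS]product_measure1E//.
    by rewrite [X in (X * _)%E]lebesgue_measure_set1 mul0e.
  apply/seteqP; split => [[x y]|[x y]] /=; rewrite b0 mul0r addr0.
    by move=> <-; split => //; field.
  by move=> [-> _]; field.
set A := [set _ | _].
have -> : leb2 R A =
    (\int[@lebesgue_measure R]_x (@lebesgue_measure R) (xsection A x))%E by [].
rewrite integral0_eq// => x _ /=.
rewrite (_ : xsection _ _ = [set ((c - a * x) / b : R)]).
  exact: lebesgue_measure_set1.
rewrite /xsection; apply/seteqP; split => [y|y] /=; rewrite inE/=.
  by move=> <-; rewrite addrC addKr mulrC mulKf.
have E : a * (x : R) + b * ((c - a * (x : R)) / b) = c by field.
by move=> ->; exact: E.
Qed.

Lemma leb2_box (a b c d : R) : a <= b -> c <= d ->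
  leb2 R (`]a, b[ `*` `]c, d[ : set (plane R)) = ((b - a) * (d - c))%:E.
Proof.
move=> ab cd; rewrite [LHS]product_measure1E//=; try exact: measurable_itv.
rewrite [X in (X * _)%E]lebesgue_measure_itv [X in (_ * X)%E]lebesgue_measure_itv /= !lte_fin EFinM.
have E (u v : R) : u <= v -> (if u < v then (v - u)%:E else 0%E) = (v - u)%:E.
  by case: ltgtP => // -> _; rewrite subrr.
by rewrite -(E _ _ ab) -(E _ _ cd).
Qed.

Lemma leb2_gt0 A B : open A -> A !=set0 -> A `<=` B -> measurable B ->
  (0 < leb2 R B)%E.
Proof.
move=> /open_enormP oA [x /oA[r r0 hr]] AB mB.
have r2 : 0 < r / 2 by rewrite divr_gt0.
have sub : `](x.1 - r/2 : R), x.1 + r/2[ `*` `](x.2 - r/2 : R), x.2 + r/2[ `<=` B.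
  move=> y [/=]; rewrite !in_itv/= => /andP[? ?] /andP[? ?]; apply/AB/hr.
  apply: le_lt_trans (enorm_le_norm1 _) _ => /=.
  by rewrite (splitr r) ltrD// ltr_norml; lra.
apply: (@lt_le_trans _ _ (leb2 R
  (`](x.1 - r/2 : R), x.1 + r/2[ `*` `](x.2 - r/2 : R), x.2 + r/2[))).
  by rewrite leb2_box ?lte_fin ?mulr_gt0//; lra.
by apply: le_measure; rewrite ?inE//; apply: measurableX; exact: measurable_itv.
Qed.

Lemma leb2_lty A (K : R) : measurable A -> (forall x, A x -> enorm x < K) ->
  (leb2 R A < +oo)%E.
Proof.
move=> mA AK; have [->|/set0P[x0 Ax0]] := eqVneq A set0; first by rewrite measure0.
have K0 : 0 < K by apply: le_lt_trans (AK _ Ax0); exact: enorm_ge0.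
apply: (@le_lt_trans _ _ (leb2 R (`](-K), K[ `*` `](-K), K[))).
  apply: le_measure; rewrite ?inE//.
    by apply: measurableX; exact: measurable_itv.
  move=> x Ax; split; rewrite /= in_itv/= -ltr_norml.
    exact: le_lt_trans (normr_fst_le_enorm x) (AK _ Ax).
  exact: le_lt_trans (normr_snd_le_enorm x) (AK _ Ax).
by rewrite leb2_box ?ltry//; lra.
Qed.

End PlaneTopology.

Section PlaneValued.
Context {R : realType} d (U : measurableType d).

Lemma measurable_fun_plane_fst (A : set U) (f : U -> plane R) :
  measurable_fun A f -> measurable_fun A (fun u => (f u).1).
Proof. exact: (measurableT_comp (@measurable_fst _ _ _ _)). Qed.

Lemma measurable_fun_plane_snd (A : set U) (f : U -> plane R) :
  measurable_fun A f -> measurable_fun A (fun u => (f u).2).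
Proof. exact: (measurableT_comp (@measurable_snd _ _ _ _)). Qed.

Lemma measurable_fun_planeB (A : set U) (f g : U -> plane R) : measurable A ->
  measurable_fun A f -> measurable_fun A g ->
  measurable_fun A (fun u => f u - g u).
Proof.
move=> mA mf mg.
apply: (@eq_measurable_fun _ _ _ _ _
  (fun u => (((f u).1 : R) - (g u).1, ((f u).2 : R) - (g u).2))).
  by move=> u _.
apply: measurable_fun_pair_on => //; apply: measurable_funB.
- exact: measurable_fun_plane_fst.
- exact: measurable_fun_plane_fst.
- exact: measurable_fun_plane_snd.
- exact: measurable_fun_plane_snd.
Qed.

Lemma measurable_enorm (A : set U) (f : U -> plane R) :
  measurable A -> measurable_fun A f ->
  measurable_fun A (fun u => enorm (f u) : measurableTypeR R).
Proof.
move=> mA mf.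
have me : measurable_fun (setT : set (plane R)) (@enorm R : plane R -> measurableTypeR R).
  apply: (@lipschitz_measurable_fun _ _ _ 1) => // y z _ _.
  by rewrite mul1r; exact: ler_dist_enorm.
exact: measurableT_comp me mf.
Qed.

End PlaneValued.

Section Bisector.
Context {R : realType}.

(** Subtracting the squares of both sides leaves an affine equation. *)
Lemma leb2_bisector (p q : plane R) : p <> q ->
  measurable [set x : plane R | enorm (x - p) = enorm (x - q)] /\
  leb2 R [set x : plane R | enorm (x - p) = enorm (x - q)] = 0%E.
Proof.
move=> pq.
have -> : [set x : plane R | enorm (x - p) = enorm (x - q)] =
   [set x : plane R | ((q.1 : R) - p.1) * (x.1 : R) + ((q.2 : R) - p.2) * (x.2 : R) =
     ((q.1 : R) ^+ 2 + (q.2 : R) ^+ 2 - (p.1 : R) ^+ 2 - (p.2 : R) ^+ 2) / 2].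
  apply/seteqP; split => x /= h.
    have := congr1 (fun u => u ^+ 2) h; rewrite !sqr_enorm /=.
    move: (x.1 : R) (x.2 : R) (p.1 : R) (p.2 : R) (q.1 : R) (q.2 : R).
    by move=> x1 x2 p1 p2 q1 q2 h'; lra.
  apply/eqP; rewrite -(@eqrXn2 _ 2)//; try exact: enorm_ge0.
  apply/eqP; rewrite !sqr_enorm /=; move: h.
  move: (x.1 : R) (x.2 : R) (p.1 : R) (p.2 : R) (q.1 : R) (q.2 : R).
  by move=> x1 x2 p1 p2 q1 q2 h'; lra.
split; last first.
  apply: leb2_line.
  have [e1|] := eqVneq (q.1 : R) (p.1 : R); last by rewrite subr_eq0; left.
  right; rewrite subr_eq0; apply/eqP => e2; apply: pq; exact: plane_eq.
set f := fun x : plane R => ((q.1 : R) - p.1) * (x.1 : R) + ((q.2 : R) - p.2) * (x.2 : R).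
set c := _ / 2.
have mf : measurable_fun setT (f : plane R -> measurableTypeR R).
  by apply: measurable_funD; apply: measurable_funM.
have := mf measurableT [set c] (measurable_set1 c).
by rewrite setTI.
Qed.

End Bisector.

(** * Plane lattices *)

Section LatticeCoordinates.
Context {R : realType}.
Variables (l1 l2 : plane R).
Hypothesis indep : forall a b : R, a *: l1 + b *: l2 = 0 -> a = 0 /\ b = 0.

Let a1 : R := l1.1. Let a2 : R := l1.2. Let b1 : R := l2.1. Let b2 : R := l2.2.
Definition lattice_det : R := (l1.1 : R) * l2.2 - (l1.2 : R) * l2.1.
(** The coordinates in the basis (l1, l2), by Cramer's rule. *)
Definition coord1 (x : plane R) : R :=
  ((x.1 : R) * l2.2 - (x.2 : R) * l2.1) / lattice_det.
Definition coord2 (x : plane R) : R :=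
  ((l1.1 : R) * x.2 - (l1.2 : R) * x.1) / lattice_det.

Lemma lattice_det_neq0 : lattice_det != 0.
Proof.
apply/eqP => d0; rewrite /lattice_det -/a1 -/a2 -/b1 -/b2 in d0.
have h1 : a1 = 0.
  have [|_ /eqP] := indep (a := b1) (b := - a1); last by rewrite oppr_eq0 => /eqP.
  apply: plane_eq; rewrite ?fst_comb ?snd_comb /=.
    by rewrite -/a1 -/b1; ring.
  by rewrite -/a2 -/b2; transitivity (- (a1 * b2 - a2 * b1)); [ring|rewrite d0 oppr0].
have h2 : a2 = 0.
  have [|_ /eqP] := indep (a := b2) (b := - a2); last by rewrite oppr_eq0 => /eqP.
  apply: plane_eq; rewrite ?fst_comb ?snd_comb /=.
    by rewrite -/a1 -/b1; transitivity (a1 * b2 - a2 * b1); [ring|].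
  by rewrite -/a2 -/b2; ring.
have [|/eqP + _] := indep (a := 1) (b := 0); last by rewrite oner_eq0.
apply: plane_eq; rewrite ?fst_comb ?snd_comb /=.
  by rewrite -/a1 h1 mulr0 mul0r addr0.
by rewrite -/a2 h2 mulr0 mul0r addr0.
Qed.

Lemma coordE x : x = coord1 x *: l1 + coord2 x *: l2.
Proof.
have := lattice_det_neq0; rewrite /coord1 /coord2 /lattice_det => d0.
rewrite -/a1 -/a2 -/b1 -/b2 in d0 *.
apply: plane_eq; rewrite ?fst_comb ?snd_comb -?/a1 -?/a2 -?/b1 -?/b2.
  by move: (x.1 : R) (x.2 : R) => u w; field.
by move: (x.1 : R) (x.2 : R) => u w; field.
Qed.

Lemma coord_comb a b :
  coord1 (a *: l1 + b *: l2) = a /\ coord2 (a *: l1 + b *: l2) = b.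
Proof.
have := lattice_det_neq0; rewrite /coord1 /coord2 fst_comb snd_comb /lattice_det => d0.
rewrite -/a1 -/a2 -/b1 -/b2 in d0 *.
by split; field.
Qed.

Lemma coord1B x y : coord1 (x - y) = coord1 x - coord1 y.
Proof.
rewrite /coord1 -mulrBl; congr (_ / _).
case: x y => [x x'] [y y'] /=; rewrite -/b1 -/b2.
move: (x : R) (y : R) (x' : R) (y' : R) => {}x {}y {}x' {}y'; ring.
Qed.

Lemma coord2B x y : coord2 (x - y) = coord2 x - coord2 y.
Proof.
rewrite /coord2 -mulrBl; congr (_ / _).
case: x y => [x x'] [y y'] /=; rewrite -/a1 -/a2.
move: (x : R) (y : R) (x' : R) (y' : R) => {}x {}y {}x' {}y'; ring.
Qed.

Definition coord_bound : R := (enorm l1 + enorm l2) / `|lattice_det|.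

Lemma coord_bound_ge0 : 0 <= coord_bound.
Proof. by rewrite divr_ge0// addr_ge0// enorm_ge0. Qed.

Lemma coord1_le x : `|coord1 x| <= coord_bound * enorm x.
Proof.
rewrite /coord1 normrM normfV /coord_bound mulrAC ler_wpM2r ?invr_ge0//.
have := dot_le_enorm x (l2.2, - l2.1); have := dot_le_enorm x (- l2.2, l2.1).
have -> : enorm ((- l2.2, l2.1) : plane R) = enorm l2.
  by rewrite /enorm /= sqrrN addrC.
have -> : enorm ((l2.2, - l2.1) : plane R) = enorm l2.
  by rewrite /enorm /= sqrrN addrC.
rewrite /dot /= ler_norml -/b1 -/b2 => h1 h2.
have := mulr_ge0 (enorm_ge0 l1) (enorm_ge0 x).
move: h1 h2; rewrite !mulrN mulrDl (mulrC (enorm l2)).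
by move: (x.1 : R) (x.2 : R) => u v; lra.
Qed.

Lemma coord2_le x : `|coord2 x| <= coord_bound * enorm x.
Proof.
rewrite /coord2 normrM normfV /coord_bound mulrAC ler_wpM2r ?invr_ge0//.
have := dot_le_enorm x (l1.2, - l1.1); have := dot_le_enorm x (- l1.2, l1.1).
have -> : enorm ((- l1.2, l1.1) : plane R) = enorm l1.
  by rewrite /enorm /= sqrrN addrC.
have -> : enorm ((l1.2, - l1.1) : plane R) = enorm l1.
  by rewrite /enorm /= sqrrN addrC.
rewrite /dot /= ler_norml -/a1 -/a2 => h1 h2.
have := mulr_ge0 (enorm_ge0 l2) (enorm_ge0 x).
move: h1 h2; rewrite !mulrN mulrDl (mulrC (enorm l1)) (mulrC a1) (mulrC a2).
by move: (x.1 : R) (x.2 : R) => u v; lra.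
Qed.

Lemma coord1_lip x y : `|coord1 x - coord1 y| <= coord_bound * enorm (x - y).
Proof. by rewrite -coord1B coord1_le. Qed.

Lemma coord2_lip x y : `|coord2 x - coord2 y| <= coord_bound * enorm (x - y).
Proof. by rewrite -coord2B coord2_le. Qed.

(** Only the lattice vectors no farther from u than the origin compete; their
    coordinates are bounded, so that there are finitely many of them. *)
Lemma lattice_nearest (u : plane R) : exists2 k, lattice l1 l2 k &
  forall k', lattice l1 l2 k' -> enorm (u - k) <= enorm (u - k').
Proof.
(* A lattice vector k with |u - k| <= |u| satisfies |k| <= 2 |u|, so both of
   its integer coordinates are at most M in absolute value; ordinals below
   2 M + 1 encode the integers from - M to M. *)
pose M := (Num.truncn (coord_bound * (enorm u + enorm u))).+1.
pose pt (p : 'I_(M.*2.+1) * 'I_(M.*2.+1)) : plane R :=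
  ((p.1%:Z - M%:Z)%:~R : R) *: l1 + ((p.2%:Z - M%:Z)%:~R : R) *: l2.
have MM : (M < M.*2.+1)%N by rewrite ltnS -addnn leq_addr.
pose p0 := (Ordinal MM, Ordinal MM).
have pt0 : pt p0 = 0 by rewrite /pt /= subrr !scale0r addr0.
pose g p := enorm (u - pt p).
have [p _ pmin] := @arg_minP _ _ _ p0 xpredT g isT.
exists (pt p); first by exists (p.1%:Z - M%:Z), (p.2%:Z - M%:Z).
move=> k' [m [n kE]].
have [hk|hk] := leP (enorm u) (enorm (u - k')).
  apply: le_trans hk; have := pmin p0 isT.
  by rewrite {2}/g pt0 subr0.
have kb : coord_bound * enorm k' < M%:R.
  apply: le_lt_trans (truncnS_gt _); rewrite ler_wpM2l ?coord_bound_ge0//.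
  have -> : k' = u - (u - k') by rewrite subKr.
  by apply: le_trans (ler_enormD _ _) _; rewrite enormN lerD2l ltW.
have [c1 c2] := coord_comb m%:~R n%:~R; rewrite -kE in c1 c2.
have bnd (c : R) (i : int) : c = i%:~R -> `|c| <= coord_bound * enorm k' ->
    exists j : 'I_(M.*2.+1), j%:Z - M%:Z = i.
  move=> -> ib; have : `|i%:~R : R| < M%:R by exact: le_lt_trans kb.
  rewrite -intr_norm -[M%:R]/(M%:Z%:~R) ltr_int => iM.
  have iM0 : (absz (i + M%:Z)%R < M.*2.+1)%N by move: iM; clear; lia.
  by exists (Ordinal iM0) => /=; move: iM; clear; lia.
have [i1 e1] := bnd _ _ c1 (coord1_le _).
have [i2 e2] := bnd _ _ c2 (coord2_le _).
have := pmin (i1, i2) isT; rewrite /g.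
by rewrite {2}/pt /= e1 e2 -kE.
Qed.

End LatticeCoordinates.

(** * Bounded domains and flat tori *)

Section DomainGeometry.
Context {R : realType} (D : domain R).
Hypothesis D_ok : admissible_domain D.
Implicit Types (x y z k : plane R).

(** The group by which the plane is divided, so that bounded domains and tori
    share their proofs: [dist] is the distance to the nearest translate by a
    period ([dist_spec]). *)
Definition periods : set (plane R) :=
  match D with BoundedDomain _ => [set 0] | FlatTorus l1 l2 => lattice l1 l2 end.

Lemma periods0 : periods 0.
Proof.
rewrite /periods; case: D => [U|l1 l2] //.
by exists 0, 0; rewrite !scale0r addr0.
Qed.

Lemma periodsD k k' : periods k -> periods k' -> periods (k + k').
Proof.
rewrite /periods; case: D => [U -> ->|l1 l2]; first by rewrite /= addr0.
move=> [a [b ->]] [a' [b' ->]]; exists (a + a'), (b + b').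
by rewrite !rmorphD/= !scalerDl addrACA.
Qed.

Lemma periodsN k : periods k -> periods (- k).
Proof.
rewrite /periods; case: D => [U ->|l1 l2]; first by rewrite /= oppr0.
by move=> [a [b ->]]; exists (- a), (- b); rewrite !rmorphN/= !scaleNr opprD.
Qed.

Lemma periodsB k k' : periods k -> periods k' -> periods (k - k').
Proof. by move=> pk pk'; apply: periodsD => //; exact: periodsN. Qed.

(** Enumeration of [periods] by a countable type. *)
Definition period (n : int * int) : plane R :=
  match D with BoundedDomain _ => 0
  | FlatTorus l1 l2 => (n.1%:~R : R) *: l1 + (n.2%:~R : R) *: l2 end.

Lemma periodsP k : periods k <-> exists n, k = period n.
Proof.
rewrite /periods /period; case: D => [U|l1 l2].
  by split => [->|[_ ->]]; first exists (0, 0).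
by split => [[a [b ->]]|[[a b] ->]]; [exists (a, b)|exists a, b].
Qed.

Lemma same_pointE x y : same_point D x y <-> periods (x - y).
Proof.
rewrite /same_point /periods; case: D => [U|l1 l2] //.
by split => [->|/eqP]; rewrite ?subrr//= subr_eq0 => /eqP.
Qed.

Lemma dist_spec x y :
  (exists2 k, periods k & dist D x y = enorm (x - y - k)) /\
  forall k, periods k -> dist D x y <= enorm (x - y - k).
Proof.
move: D_ok; rewrite /dist /periods; case: D => [U|l1 l2] /= H.
  by split => [|k ->]; [exists 0|]; rewrite ?subr0.
set S := [set _ | _ in _].
have lbS : has_inf S.
  split; first by exists (enorm (x - y - 0)), 0 => //; exists 0, 0; rewrite !scale0r addr0.
  by exists 0 => _ [k _ <-]; exact: enorm_ge0.
have infle k : lattice l1 l2 k -> inf S <= enorm (x - y - k).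
  by move=> lk; apply: (ge_inf lbS.2); exists k.
split => //; have [k lk kmin] := lattice_nearest H (x - y).
exists k => //; apply/eqP; rewrite eq_le infle//=.
by apply: (lb_le_inf lbS.1) => _ [k' /kmin + <-].
Qed.

Lemma dist_le k x y : periods k -> dist D x y <= enorm (x - y - k).
Proof. by move: k; have [] := dist_spec x y. Qed.

Lemma dist_attained x y : exists2 k, periods k & dist D x y = enorm (x - y - k).
Proof. by have [] := dist_spec x y. Qed.

Lemma dist_ge0 x y : 0 <= dist D x y.
Proof. by have [k _ ->] := dist_attained x y; exact: enorm_ge0. Qed.

Lemma dist_le_enorm x y : dist D x y <= enorm (x - y).
Proof. by have := dist_le x y periods0; rewrite subr0. Qed.

Lemma dist_triangle y x z : dist D x z <= dist D x y + dist D y z.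
Proof.
have [k pk ->] := dist_attained x y; have [k' pk' ->] := dist_attained y z.
apply: le_trans (dist_le x z (periodsD pk pk')) _.
have -> : x - z - (k + k') = (x - y - k) + (y - z - k').
  by rewrite [RHS]addrACA -opprD addrA subrK.
exact: ler_enormD.
Qed.

Lemma dist_same x y : periods (x - y) -> dist D x y = 0.
Proof.
move=> pxy; apply/eqP; rewrite eq_le dist_ge0 andbT.
by have := dist_le x y pxy; rewrite subrr enorm0.
Qed.

Lemma dist0_periods x y : dist D x y = 0 -> periods (x - y).
Proof.
have [k pk ->] := dist_attained x y; move/enorm0_eq0/eqP.
by rewrite subr_eq0 => /eqP ->.
Qed.

Lemma distC x y : dist D x y = dist D y x.
Proof.
have h a b : dist D a b <= dist D b a.
  have [k pk ->] := dist_attained b a.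
  apply: le_trans (dist_le a b (periodsN pk)) _.
  by rewrite -enormN !opprD !opprK (addrC (- a)).
by apply/eqP; rewrite eq_le !h.
Qed.

Lemma dist_congl x x' y : periods (x - x') -> dist D x y = dist D x' y.
Proof.
move=> p; apply/eqP; rewrite eq_le; apply/andP; split.
  by have := dist_triangle x' x y; rewrite (dist_same p) add0r.
have p' : periods (x' - x) by rewrite -opprB; exact: periodsN.
by have := dist_triangle x x' y; rewrite (dist_same p') add0r.
Qed.

Lemma dist_congr x y y' : periods (y - y') -> dist D x y = dist D x y'.
Proof. by move=> p; rewrite !(distC x); exact: dist_congl. Qed.

Lemma dist_lipl x x' y : `|dist D x y - dist D x' y| <= enorm (x - x').
Proof.
have h a b : dist D a y - dist D b y <= enorm (a - b).
  have := dist_triangle b a y; have := dist_le_enorm a b; lra.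
by rewrite ler_norml h andbT lerNl opprB enormBC h.
Qed.

Lemma carrier_bounded :
  exists2 K : R, 0 < K & forall x, carrier D x -> enorm x < K.
Proof.
move: D_ok; rewrite /carrier; case: D => [U|l1 l2] /=.
  move=> [_ _ [K [Kr hK]] _ _].
  have K1 : K < `|K| + 1 by have := ler_norm K; lra.
  exists (`|K| + 1 + (`|K| + 1) + 1) => [|x Ux]; first by have := normr_ge0 K; lra.
  have := hK _ K1 x Ux; rewrite /= {1}/Num.norm /= ge_max => /andP[h1 h2].
  have := enorm_le_norm1 x; lra.
move=> _; exists (enorm l1 + enorm l2 + 1).
  by have := enorm_ge0 l1; have := enorm_ge0 l2; lra.
move=> x [a [b [/andP[a0 a1] /andP[b0 b1] ->]]].
apply: le_lt_trans (ler_enormD _ _) _; rewrite !enormZ !ger0_norm//.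
have h1 := ler_wpM2r (enorm_ge0 l1) (ltW a1).
have h2 := ler_wpM2r (enorm_ge0 l2) (ltW b1).
by lra.
Qed.

Lemma measurable_representative : measurable (representative D).
Proof.
move: D_ok; rewrite /representative; case: D => [U [_ oU _ _ _]|l1 l2 _] //.
exact: plane_open_measurable.
Qed.

Lemma measurable_carrier : measurable (carrier D).
Proof.
move: D_ok; rewrite /carrier; case: D => [U [_ oU _ _ _]|l1 l2 indep].
  exact: plane_open_measurable.
have m1 := @lipschitz_measurable_fun R setT (coord1 l1 l2) _
  (coord_bound_ge0 _ _) measurableT (fun x y _ _ => coord1_lip l1 l2 x y).
have m2 := @lipschitz_measurable_fun R setT (coord2 l1 l2) _
  (coord_bound_ge0 _ _) measurableT (fun x y _ _ => coord2_lip l1 l2 x y).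
rewrite (_ : [set _ | _] = (setT `&` coord1 l1 l2 @^-1` `[0, 1[) `&`
   (setT `&` coord2 l1 l2 @^-1` `[0, 1[)).
  by apply: measurableI; [apply: m1|apply: m2].
apply/seteqP; split => [x [a [b [a01 b01 ->]]]|x [[_ a01] [_ b01]]].
  have [h1 h2] := coord_comb indep a b; split; split => //=.
    by rewrite h1 in_itv.
  by rewrite h2 in_itv.
by exists (coord1 l1 l2 x), (coord2 l1 l2 x); rewrite -coordE.
Qed.

(** The fundamental cell of a torus is half-open, so its points need not be
    interior; but each one is a limit of interior points, by increasing both
    coordinates a little. This makes Voronoi cells have positive area. *)
Lemma carrier_fat x (r : R) : carrier D x -> 0 < r ->
  exists A, [/\ open A, A !=set0, A `<=` carrier D &
    forall y, A y -> enorm (y - x) < r].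
Proof.
move: D_ok; rewrite /carrier; case: D => [U [_ oU _ _ _]|l1 l2 indep] Cx r0.
  have /open_enormP/(_ x Cx)[s s0 hs] := oU.
  have m0 : 0 < Num.min r s by rewrite lt_min r0.
  exists [set y | enorm (y - x) < Num.min r s]; split.
  - apply: (@open_lt_lipschitz _ _ 1) => // y z.
    by rewrite mul1r (le_trans (ler_dist_enorm _ _))// opprB addrA subrK.
  - by exists x => /=; rewrite subrr enorm0.
  - by move=> y /=; rewrite lt_min => /andP[_ /hs].
  - by move=> y /=; rewrite lt_min => /andP[].
case: Cx => a [b [/andP[a0 a1] /andP[b0 b1] xE]].
pose l := enorm l1 + enorm l2 + 1.
have l0 : 0 < l by have := enorm_ge0 l1; have := enorm_ge0 l2; rewrite /l; lra.
pose s := Num.min (r / l) (Num.min (1 - a) (1 - b)).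
have s0 : 0 < s by rewrite !lt_min divr_gt0// !subr_gt0 a1.
have sr : s * l <= r by rewrite -ler_pdivlMr// ge_min lexx.
have sa : s <= 1 - a by rewrite !ge_min lexx orbT.
have sb : s <= 1 - b by rewrite !ge_min lexx !orbT.
have open_c (f : plane R -> R) (c d : R) :
    (forall y z, `|f y - f z| <= coord_bound l1 l2 * enorm (y - z)) ->
    open [set y | c < f y < d].
  move=> fl; rewrite (_ : [set _ | _] = [set y | - f y < - c] `&` [set y | f y < d]).
    apply: openI; last exact: (open_lt_lipschitz (coord_bound_ge0 l1 l2) fl).
    apply: (open_lt_lipschitz (coord_bound_ge0 l1 l2)) => y z.
    by rewrite -opprD normrN.
  apply/seteqP; split => y /=; first by move=> /andP[cy yd]; rewrite ltrN2.
  by rewrite ltrN2 => -[-> ->].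
exists ([set y | a < coord1 l1 l2 y < a + s] `&` [set y | b < coord2 l1 l2 y < b + s]); split.
- by apply: openI; apply: open_c; [exact: coord1_lip|exact: coord2_lip].
- exists ((a + s / 2) *: l1 + (b + s / 2) *: l2).
  by have [h1 h2] := coord_comb indep (a + s / 2) (b + s / 2); split => /=; rewrite ?h1 ?h2; lra.
- move=> y [/= /andP[ya ya'] /andP[yb yb']].
  by exists (coord1 l1 l2 y), (coord2 l1 l2 y); split; [lra|lra|rewrite -coordE].
move=> y [/= /andP[ya ya'] /andP[yb yb']].
rewrite [y](coordE indep) xE opprD addrACA -!scalerBl.
apply: le_lt_trans (ler_enormD _ _) _; rewrite !enormZ.
apply: lt_le_trans sr; rewrite /l !mulrDr mulr1 ltr_pwDr// lerD//.
  by rewrite ler_wpM2r ?enorm_ge0// ler_norml; lra.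
by rewrite ler_wpM2r ?enorm_ge0// ler_norml; lra.
Qed.

Lemma reduce_spec x : representative D x ->
  carrier D (reduce D x) /\ periods (x - reduce D x).
Proof.
move=> rx; have [y [Cy /same_pointE pxy]] : exists y, carrier D y /\ same_point D x y.
  move: D_ok rx; rewrite /carrier /representative /same_point.
  case: D => [U _ Ux|l1 l2 indep _]; first by exists x.
  set a := coord1 l1 l2 x; set b := coord2 l1 l2 x.
  have frac (c : R) : 0 <= c - (Num.floor c)%:~R < 1.
    have := floor_le c; have := lt_succ_floor c; rewrite intrD; lra.
  exists ((a - (Num.floor a)%:~R) *: l1 + (b - (Num.floor b)%:~R) *: l2); split.
    exists (a - (Num.floor a)%:~R), (b - (Num.floor b)%:~R).
    by split; [exact: frac|exact: frac|].
  exists (Num.floor a), (Num.floor b).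
  rewrite {1}[x](coordE indep) -/a -/b opprD addrACA -!scalerBl.
  by rewrite !subKr.
rewrite /reduce; case: xgetP => [z -> [Cz /same_pointE pxz]//|/(_ y)[]].
by split => //; apply/same_pointE.
Qed.

Lemma carrier_inj x y : carrier D x -> carrier D y -> periods (x - y) -> x = y.
Proof.
move: D_ok; rewrite /carrier /periods; case: D => [U _ _ _ /eqP|l1 l2 indep].
  by rewrite subr_eq0 => /eqP.
move=> [a [b [a01 b01 ->]]] [a' [b' [a'01 b'01 ->]]] [m [n]].
rewrite opprD addrACA -!scalerBl => E.
have [c1 c2] := coord_comb indep (a - a') (b - b').
have [c3 c4] := coord_comb indep m%:~R n%:~R.
rewrite E c3 in c1; rewrite E c4 in c2.
have small (i : int) (c c' : R) : 0 <= c < 1 -> 0 <= c' < 1 -> i%:~R = c - c' -> c = c'.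
  move=> h h' ic.
  have i1 : (-1)%:~R < i%:~R :> R by rewrite ic mulrN1z; lra.
  have i2 : i%:~R < 1%:~R :> R by rewrite ic; lra.
  rewrite !ltr_int in i1 i2; have i0 : i = 0 by move: i1 i2; clear; lia.
  by move: ic; rewrite i0 => /esym/eqP; rewrite subr_eq0 => /eqP.
by rewrite (small _ _ _ a01 a'01 c1) (small _ _ _ b01 b'01 c2).
Qed.

(** The preimage of A is the union over the countably many periods of the
    translates of the part of A inside the carrier. *)
Lemma measurable_reduce : measurable_fun (representative D) (reduce D).
Proof.
move=> mD A mA.
have -> : representative D `&` reduce D @^-1` A = \bigcup_n
    (representative D `&` (fun x => x - period n) @^-1` (A `&` carrier D)).
  apply/seteqP; split => [x [rx Ax]|x [n _ [rx [Ax Cx]]]].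
    have [Cr /periodsP[n pn]] := reduce_spec rx.
    by exists n => //; split => //=; rewrite -pn subKr.
  split => //=; have [Cr pr] := reduce_spec rx.
  suff -> : reduce D x = x - period n by [].
  apply: carrier_inj => //; rewrite opprB addrCA -[reduce D x - x]opprB.
  by apply: periodsB => //; apply/periodsP; exists n.
apply: countable_bigcupT_measurable => // n.
have mf : measurable_fun (representative D) (fun x => x - period n).
  apply: (@lipschitz_measurable_fun_plane _ _ _ 1) => // x y _ _.
  by rewrite mul1r opprB addrA subrK.
by apply: mf => //; apply: measurableI => //; exact: measurable_carrier.
Qed.

End DomainGeometry.

(** * Voronoi cells *)

Section Cells.
Context {R : realType} (D : domain R).
Hypothesis D_ok : admissible_domain D.
Variables (N : nat) (X : 'I_N -> plane R).
Hypothesis X_rep : forall i, representative D (X i).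
Hypothesis X_distinct : forall i j, i != j -> ~ same_point D (X i) (X j).

Local Notation Omega := (cell D X).

(** The constraint part of a cell, which is open in the plane whereas the carrier
    of a torus is not. *)
Definition open_cell (i : 'I_N) : set (plane R) :=
  [set x | forall j, j != i -> dist D x (X i) < dist D x (X j)].

Lemma cellE i : Omega i = carrier D `&` open_cell i.
Proof. by []. Qed.

Lemma open_open_cell i : open (open_cell i).
Proof.
have -> : open_cell i = ~` \bigcup_(j in [set j | j != i])
    [set x | dist D x (X j) - dist D x (X i) <= 0].
  apply/seteqP; split => x /= h.
    by move=> [j /= ji]; have := h j ji; lra.
  move=> j ji; rewrite ltNge; apply/negP => le; apply: h.
  by exists j => //=; lra.
rewrite openC; apply: closed_bigcup => [|j _]; first exact: finite_finset.
have -> : [set x | dist D x (X j) - dist D x (X i) <= 0] =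
   ~` [set x | dist D x (X i) - dist D x (X j) < 0].
  apply/seteqP; split => x /=; first by move=> h; apply/negP; rewrite -leNgt; lra.
  by move/negP; rewrite -leNgt; lra.
rewrite closedC; apply: (@open_lt_lipschitz _ _ 2) => // x y.
have -> : dist D x (X i) - dist D x (X j) - (dist D y (X i) - dist D y (X j)) =
  (dist D x (X i) - dist D y (X i)) - (dist D x (X j) - dist D y (X j)) by ring.
apply: le_trans (ler_normB _ _) _; rewrite mulr_natl mulr2n.
by apply: lerD; exact: dist_lipl.
Qed.

Lemma measurable_cell i : measurable (Omega i).
Proof.
rewrite cellE; apply: measurableI; first exact: measurable_carrier.
by apply: plane_open_measurable; exact: open_open_cell.
Qed.

Lemma cell_disjoint i j x : Omega i x -> Omega j x -> i = j.
Proof.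
move=> [_ hi] [_ hj]; apply/eqP/negPn/negP => ij.
have h1 := hj i ij; rewrite eq_sym in ij; have h2 := hi j ij; lra.
Qed.

(** A generator is at distance 0 from itself, and at positive distance from the
    others because they are distinct points of the domain. *)
Lemma cell_reduce i : Omega i (reduce D (X i)).
Proof.
have [Cr pr] := reduce_spec D_ok (X_rep i); split => // j ji.
have pr' : periods D (reduce D (X i) - X i) by rewrite -opprB; exact: periodsN.
rewrite (dist_same D_ok pr') lt_neqAle dist_ge0// andbT.
rewrite (dist_congl D_ok _ pr'); apply/eqP => /esym /(dist0_periods D_ok) h.
by rewrite eq_sym in ji; apply: (X_distinct ji); apply/same_pointE.
Qed.

Lemma leb2_cell_gt0 i : (0 < leb2 R (Omega i))%E.
Proof.
have [Cr hr] := cell_reduce i.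
have /open_enormP/(_ _ hr)[r r0 rO] : open (open_cell i) by exact: open_open_cell.
have [A [oA A0 AC Ar]] := carrier_fat D_ok Cr r0.
apply: (leb2_gt0 oA A0 _ (measurable_cell i)) => y Ay.
by split; [exact: AC|exact/rO/Ar].
Qed.

Lemma leb2_cell_lty i : (leb2 R (Omega i) < +oo)%E.
Proof.
have [K K0 CK] := carrier_bounded D_ok.
apply: (leb2_lty (measurable_cell i) (K := K)) => x [Cx _]; exact: CK.
Qed.

Lemma leb2_cell i : leb2 R (Omega i) = (area (Omega i))%:E.
Proof. by rewrite /area fineK// ge0_fin_numE// leb2_cell_lty. Qed.

Lemma area_cell_gt0 i : 0 < area (Omega i).
Proof. by rewrite -lte_fin -leb2_cell leb2_cell_gt0. Qed.

(** A point of the domain outside all cells has two nearest generators, hence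
    it lies on the bisector of two of their representatives. There are countably
    many such bisectors. *)
Lemma carrier_cell_negligible : (0 < N)%N ->
  (leb2 R).-negligible (carrier D `\` \bigcup_i Omega i).
Proof.
move=> N0.
pose B (p : 'I_N * 'I_N * (int * int) * (int * int)) : set (plane R) :=
  if p.1.1.1 == p.1.1.2 then set0 else
  [set x | enorm (x - (X p.1.1.1 + period D p.1.2)) =
           enorm (x - (X p.1.1.2 + period D p.2))].
have nB p : (leb2 R).-negligible (B p).
  rewrite /B; case: ifPn => ij; first exact: negligible_set0.
  have [|mB B0] := @leb2_bisector R (X p.1.1.1 + period D p.1.2)
     (X p.1.1.2 + period D p.2); last by exists (B p); split; rewrite /B ?(negbTE ij).
  move=> E; apply: (X_distinct ij); apply/same_pointE.
  have -> : X p.1.1.1 - X p.1.1.2 = period D p.2 - period D p.1.2.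
    rewrite -{1}[X p.1.1.1](addrK (period D p.1.2)) E addrAC.
    by rewrite (addrC (X _)) addrK.
  by apply: periodsB; apply/periodsP; eexists.
have := @negligible_bigcup _ _ _ (leb2 R)
  (fun n => if unpickle n is Some p then B p else set0).
move=> /(_ _) h; apply: negligibleS (h _); last first.
  by move=> n; case: unpickle => [p|]; [exact: nB|exact: negligible_set0].
move=> x [Cx nO].
have [i _ imin] := @arg_minP _ _ _ (Ordinal N0) xpredT (fun i => dist D x (X i)) isT.
have : ~ open_cell i x by move=> oi; apply: nO; exists i.
move=> /existsNP[j /not_implyP[ji /negP]]; rewrite -leNgt => dji.
have dE : dist D x (X i) = dist D x (X j).
  by apply/eqP; rewrite eq_le dji imin.
have [_ /periodsP[n ->] dn] := dist_attained D_ok x (X i).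
have [_ /periodsP[m ->] dm] := dist_attained D_ok x (X j).
exists (pickle (i, j, n, m)); first by [].
rewrite pickleK /B /= eq_sym (negbTE ji) /=.
by rewrite !opprD !addrA -dn -dm.
Qed.

Lemma dist_bounded : exists2 K, 0 <= K &
  forall x y, carrier D x -> carrier D y -> dist D x y <= K.
Proof.
have [K K0 CK] := carrier_bounded D_ok; exists (K + K); first by lra.
move=> x y /CK xK /CK yK; apply: le_trans (dist_le_enorm D_ok x y) _.
by apply: le_trans (ler_enormD _ _) _; rewrite enormN; lra.
Qed.

Lemma dist_le_diam A x y : A `<=` carrier D -> A x -> A y -> dist D x y <= diam D A.
Proof.
move=> AC Ax Ay; have [K K0 dK] := dist_bounded.
apply: ub_le_sup; last by exists x, y.
by exists K => _ [u [w [/AC Cu /AC Cw ->]]]; exact: dK.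
Qed.

Lemma diam_le A K : 0 <= K ->
  (forall x y, A x -> A y -> dist D x y <= K) -> diam D A <= K.
Proof.
move=> K0 AK; rewrite /diam; set S := [set _ | _].
have [->|/set0P S0] := eqVneq S set0; first by rewrite sup0.
by apply: ge_sup => // _ [x [y [Ax Ay ->]]]; exact: AK.
Qed.

Lemma max_diam_le K : 0 <= K ->
  (forall x y, carrier D x -> carrier D y -> dist D x y <= K) -> max_diam D X <= K.
Proof.
move=> K0 CK; rewrite /max_diam; apply: bigmax_le => // i _.
by apply: diam_le => // x y [Cx _] [Cy _]; exact: CK.
Qed.

(** The generator may be a lift outside the carrier; its reduction is a point of
    its cell at the same distance from x. *)
Lemma dist_generator_le i x : Omega i x -> dist D x (X i) <= max_diam D X.
Proof.
move=> Ox; have [_ pr] := reduce_spec D_ok (X_rep i).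
rewrite (dist_congr D_ok _ pr).
have sub : Omega i `<=` carrier D by move=> z [].
have h := dist_le_diam sub Ox (cell_reduce i).
apply: (le_trans h).
exact: (le_bigmax _ (fun i => diam D (Omega i)) i).
Qed.

End Cells.

Section Partition.
Context {R : realType} (D : domain R).
Hypothesis D_ok : admissible_domain D.
Variables (N : nat) (X : 'I_N -> plane R).
Hypotheses (N_gt0 : (0 < N)%N)
  (X_distinct : forall i j, i != j -> ~ same_point D (X i) (X j)).

(** The cells are disjoint and fill the carrier up to a null set. *)
Lemma integral_cells (r : plane R -> \bar R) (B : set (plane R)) :
  measurable_fun (carrier D) r -> (forall x, carrier D x -> 0 <= r x)%E ->
  measurable B ->
  (\int[leb2 R]_(x in carrier D `&` B) r x =
   \sum_(i < N) \int[leb2 R]_(x in cell D X i `&` B) r x)%E.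
Proof.
move=> mr r0 mB.
have mC := measurable_carrier D_ok.
have mCB : measurable (carrier D `&` B) by exact: measurableI.
have mcB i : measurable (cell D X i `&` B).
  by apply: measurableI => //; exact: measurable_cell.
pose E := \big[setU/set0]_(i < N) (cell D X i `&` B).
have mE : measurable E by exact: bigsetU_measurable.
have EC : E `<=` carrier D `&` B.
  apply: (big_ind (fun A => A `<=` carrier D `&` B)) => [//|A A' h h' x [/h|/h']//|i _].
  by apply: setSI => x [].
have cE i : cell D X i `&` B `<=` E.
  by move=> x h; rewrite /E (bigD1 i)//=; left.
have nul : leb2 R ((carrier D `&` B) `\` E) = 0%E.
  apply: measure_negligible; first exact: measurableD.
  apply: negligibleS (carrier_cell_negligible D_ok X_distinct N_gt0).
  move=> x [[Cx Bx] nEx]; split => // -[i _ ix].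
  by apply: nEx; exact: (cE i).
rewrite (ge0_negligible_integral _ mCB _ _ nul); last 3 first.
- exact: measurableD.
- by apply: measurable_funS mr => //; exact: subIsetl.
- by move=> x [/r0].
rewrite setDD (setIidr EC) /E ge0_integral_bigsetU//=.
- exact: index_enum_uniq.
- move=> i j _ _ [x [[xi _] [xj _]]]; exact: cell_disjoint xi xj.
- by apply: measurable_funS mr => // x /EC[].
- by move=> x /EC[/r0].
Qed.

End Partition.

(** * Lipschitz velocity fields *)

Section VelocityNorm.
Context {R : realType} (D : domain R).
Hypothesis D_ok : admissible_domain D.

(** Guarantees that the Lipschitz seminorm inside [C01norm] is a supremum over
    a nonempty set, hence nonnegative rather than -oo. *)
Lemma carrier_two_points : exists x y, [/\ carrier D x, carrier D y & x <> y].
Proof.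
have [x0 Cx0] : carrier D !=set0.
  move: D_ok; rewrite /carrier; case: D => [U []//|l1 l2 _].
  by exists 0, 0, 0; rewrite lexx ltr01 !scale0r addr0.
have [A [/open_enormP oA [x Ax] AC _]] := carrier_fat D_ok Cx0 ltr01.
have [r r0 hr] := oA x Ax.
exists x, (x + (r / 2, 0)); split; [exact: AC|apply/AC/hr|].
  rewrite addrAC subrr add0r /enorm /= expr0n /= addr0 sqrtr_sqr gtr0_norm; lra.
move=> /(congr1 (fun u => (u.1 : R))) /= E.
have : (x.1 : R) = x.1 + r / 2 by exact: E.
lra.
Qed.

Lemma C01norm_ge0 f : (0 <= C01norm D f)%E.
Proof.
have [x [y [Cx Cy xy]]] := carrier_two_points.
apply: adde_ge0.
  apply: (@le_trans _ _ (enorm (f x))%:E); first by rewrite lee_fin enorm_ge0.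
  by apply: ereal_sup_ubound; exists x.
apply: (@le_trans _ _ (enorm (f x - f y) / dist D x y)%:E).
  by rewrite lee_fin divr_ge0 ?enorm_ge0 ?dist_ge0.
by apply: ereal_sup_ubound; exists x, y.
Qed.

Lemma periodic_reduce f x : Defs.periodic D f -> representative D x ->
  f (reduce D x) = f x.
Proof.
move=> pf rx; have [_] := reduce_spec D_ok rx.
move: pf; rewrite /Defs.periodic /periods; case: D (reduce D x) => [U|l1 l2] y.
  by move=> _ /eqP; rewrite subr_eq0 => /eqP ->.
by move=> pf px; rewrite -[in RHS](subrK y x) addrC pf.
Qed.

(** Distinct points of the carrier are at positive distance, so the difference
    quotient can be multiplied out; periodicity then extends the inequality from
    the carrier to all representatives. *)
Lemma C01norm_lip f x y : (C01norm D f < +oo)%E -> Defs.periodic D f ->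
  representative D x -> representative D y ->
  enorm (f x - f y) <= fine (C01norm D f) * dist D x y.
Proof.
move=> fin pf rx ry.
have [Cx px] := reduce_spec D_ok rx; have [Cy py] := reduce_spec D_ok ry.
rewrite -(periodic_reduce pf rx) -(periodic_reduce pf ry).
rewrite (dist_congl D_ok _ px) (dist_congr D_ok _ py).
have L0 := fine_ge0 (C01norm_ge0 f).
have [->|/eqP xy] := eqVneq (reduce D x) (reduce D y).
  by rewrite subrr enorm0 mulr_ge0// dist_ge0.
have d0 : 0 < dist D (reduce D x) (reduce D y).
  rewrite lt_neqAle dist_ge0// andbT; apply/eqP => /esym/(dist0_periods D_ok) h.
  exact/xy/(carrier_inj D_ok).
rewrite -ler_pdivrMr// -lee_fin fineK ?ge0_fin_numE ?C01norm_ge0//.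
rewrite /C01norm -[leLHS]add0e; apply: leeD.
  apply: (@le_trans _ _ (enorm (f (reduce D x)))%:E); first by rewrite lee_fin enorm_ge0.
  by apply: ereal_sup_ubound; exists (reduce D x).
by apply: ereal_sup_ubound; exists (reduce D x), (reduce D y).
Qed.

End VelocityNorm.

(** * Measurability in time *)

Section TimeMeasurability.
Context {R : realType}.
Implicit Types (x : R -> plane R).

(** Projection onto [a, b], to extend functions of time to the whole line. *)
Definition clamp (a b t : R) : R := Num.min b (Num.max a t).

Lemma clamp_itv (a b t : R) : a <= b -> a <= clamp a b t <= b.
Proof. by move=> ab; rewrite /clamp le_min ge_min le_max !lexx ab. Qed.

Lemma clamp_id (a b t : R) : a <= t <= b -> clamp a b t = t.
Proof. by move=> /andP[at_ tb]; rewrite /clamp (max_idPr at_) (min_idPr tb). Qed.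

Lemma clamp_lip (a b s t : R) : a <= b -> `|clamp a b s - clamp a b t| <= `|s - t|.
Proof.
move=> ab; rewrite /clamp.
have hmin (u w : R) : `|Num.min b u - Num.min b w| <= `|u - w|.
  have := ler_norm (u - w); have := ler_norm (- (u - w)); rewrite normrN.
  by case: (leP b u) => ?; case: (leP b w) => ? ? ?; rewrite ler_norml; lra.
apply: le_trans (hmin _ _) _.
have := ler_norm (s - t); have := ler_norm (- (s - t)); rewrite normrN.
by case: (leP a s) => ?; case: (leP a t) => ? ? ?; rewrite ler_norml; lra.
Qed.

(** The upper limit of the difference quotients with increments 1 / (n + 1) is
    Borel and equals the derivative wherever that exists. *)
Lemma derivative_version_real (T : R) (f : R -> R) : 0 < T ->
  (forall e, 0 < e -> exists2 d : R, 0 < d &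
    forall s t, 0 <= s <= T -> 0 <= t <= T -> `|s - t| < d -> `|f s - f t| < e) ->
  exists2 g : R -> R, measurable_fun (setT : set (measurableTypeR R)) (g : R -> measurableTypeR R) &
    forall t p, 0 < t < T -> is_derive t (1 : R) f p -> g t = p.
Proof.
move=> T0 uc; pose F t := f (clamp 0 T t).
have cF : continuous F.
  move=> t; apply/cvgrPdist_lt => e /uc[d d0 hd].
  near=> s; apply: hd; rewrite ?clamp_itv ?(ltW T0)//.
  apply: le_lt_trans (clamp_lip _ _ (ltW T0)) _.
  by near: s; apply: cvgr_dist_lt.
have mF := continuous_measurable_fun cF.
pose q n t : R := (F (t + n.+1%:R^-1) - F t) * n.+1%:R.
have mq n : measurable_fun (setT : set (measurableTypeR R)) (q n : R -> measurableTypeR R).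
  apply: measurable_funM => //; apply: measurable_funB => //.
  apply: (measurableT_comp mF); exact: measurable_funD.
exists (fun t => fine (limn_esup (fun n => (q n t)%:E))).
  apply: measurableT_comp; first exact: fine_measurable.
  by apply: measurable_fun_limn_esup => n; apply/measurable_EFinP; exact: mq.
move=> t p /andP[t0 tT] df.
suff : (fun n => (q n t)%:E) @ \oo --> p%:E.
  by move=> /cvg_limn_einf_sup[_ ->].
apply: cvg_EFin; first by apply: nearW.
rewrite /comp /=; apply/cvgrPdist_le => e e0.
have [r r0 hr] := is_derive_little_o df e0.
have Tt : 0 < T - t by rewrite subr_gt0.
near=> n.
have n0 : 0 < n.+1%:R :> R by rewrite ltr0n.
have nr : n.+1%:R^-1 < r :> R by near: n; exact: near_infty_natSinv_lt (PosNum r0).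
have nT : n.+1%:R^-1 < T - t.
  by near: n; exact: near_infty_natSinv_lt (PosNum Tt).
have k0 : 0 < n.+1%:R^-1 :> R by rewrite invr_gt0.
have tkT : 0 <= t + n.+1%:R^-1 <= T.
  by rewrite addr_ge0 ?(ltW t0) ?(ltW k0)//= -lerBrDl ltW.
have tT' : 0 <= t <= T by rewrite !ltW.
rewrite /q /F (clamp_id tkT) (clamp_id tT').
have := hr n.+1%:R^-1; rewrite gtr0_norm// => /(_ nr) h.
have -> : p - (f (t + n.+1%:R^-1) - f t) * n.+1%:R =
   - (f (t + n.+1%:R^-1) - f t - p * n.+1%:R^-1) * n.+1%:R by field; rewrite gt_eqF.
by rewrite normrM normrN (gtr0_norm n0) -ler_pdivlMr.
Unshelve. all: by end_near. Qed.

Lemma derivative_version (T : R) x : 0 < T -> absolutely_continuous_on 0 T x ->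
  exists2 g : R -> plane R, measurable_fun (setT : set (measurableTypeR R)) g &
    forall t p, 0 < t < T -> vderive x t p -> g t = p.
Proof.
move=> T0 acx.
have [e e0|g1 m1 h1] := @derivative_version_real T (fun s => (x s).1) T0.
  have [d d0 hd] := ac_unif_continuous acx e0; exists d => // s t sT tT st.
  exact: le_lt_trans (normr_fst_le_enorm (x s - x t)) (hd _ _ sT tT st).
have [e e0|g2 m2 h2] := @derivative_version_real T (fun s => (x s).2) T0.
  have [d d0 hd] := ac_unif_continuous acx e0; exists d => // s t sT tT st.
  exact: le_lt_trans (normr_snd_le_enorm (x s - x t)) (hd _ _ sT tT st).
exists (fun t => (g1 t, g2 t)); first exact: measurable_fun_pair.
by move=> t [p1 p2] tT [/(h1 _ _ tT) /= -> /(h2 _ _ tT) /= ->].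
Qed.

End TimeMeasurability.

Section Velocity.
Context {R : realType} (D : domain R) (T : R) (v : R -> plane R -> plane R).
Hypotheses (D_ok : admissible_domain D) (T_gt0 : 0 < T)
  (v_ok : admissible_velocity D T v).

Definition speed (s : R) : R := fine (C01norm D (v s)).

Lemma C01normE s : 0 < s < T -> C01norm D (v s) = (speed s)%:E.
Proof.
move=> sT; rewrite /speed fineK// ge0_fin_numE ?C01norm_ge0//.
by have [_ h _ _ _] := v_ok; exact: h.
Qed.

Lemma speed_ge0 s : 0 <= speed s.
Proof. by rewrite fine_ge0// C01norm_ge0. Qed.

Lemma velocity_lip s x y : 0 < s < T -> representative D x -> representative D y ->
  enorm (v s x - v s y) <= speed s * dist D x y.
Proof.
by move=> sT rx ry; have [_ fin _ per _] := v_ok; apply: C01norm_lip => //; [exact: fin|exact: per].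
Qed.

Lemma integrable_speed : (leb1 R).-integrable `]0, T[ (EFin \o speed).
Proof.
have [_ _ h _ _] := v_ok; apply: eq_integrable h => // s.
by rewrite inE/= in_itv/= => sT; rewrite C01normE.
Qed.

Lemma Lam_cumul t : t <= T -> Lam D v t = cumul (speed \_ `]0, T[) t.
Proof.
move=> tT; rewrite (cumul_restrict tT integrable_speed) /Lam /Rintegral.
congr fine; apply: eq_integral => s; rewrite inE/= in_itv/= => /andP[s0 st].
by rewrite C01normE// s0 (lt_le_trans st).
Qed.

(** Replacing x(s) by its value at the last multiple of 1 / (n + 1) before s
    gives functions that are measurable piece by piece, since v is measurable in
    time at a fixed position. They converge because v(s, .) is Lipschitz and x
    is continuous. *)
Lemma measurable_along x : absolutely_continuous_on 0 T x ->
  (forall t, 0 <= t <= T -> representative D (x t)) ->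
  measurable_fun (`]0, T[%classic : set (measurableTypeR R)) (fun s => v s (x s)).
Proof.
move=> acx rx; pose I : set (measurableTypeR R) := `]0, T[%classic.
have mI : measurable I by exact: measurable_itv.
pose a (n : nat) (s : R) : R := (Num.truncn (n.+1%:R * s))%:R / n.+1%:R.
have n0 n : 0 < n.+1%:R :> R by rewrite ltr0n.
have aE n s : 0 < s -> a n s <= s < a n s + n.+1%:R^-1.
  move=> s0; have := @truncn_itv R (n.+1%:R * s).
  rewrite mulr_ge0 ?(ltW s0)// => /(_ isT) /andP[h1 h2].
  rewrite /a ler_pdivrMr// (mulrC s) h1 /=.
  by rewrite -[X in _ + X]mul1r -mulrDl ltr_pdivlMr// (mulrC s) natr1.
have aT n s : 0 < s < T -> 0 <= a n s <= T.
  move=> /andP[s0 sT]; have /andP[h _] := aE n s s0.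
  by rewrite divr_ge0//= (le_trans h)// ltW.
have man n : measurable_fun I (fun s => v s (x (a n s))).
  pose E m : set (measurableTypeR R) := I `&` `[m%:R / n.+1%:R, m.+1%:R / n.+1%:R[.
  have mE m : measurable (E m) by apply: measurableI => //; exact: measurable_itv.
  have aEm m s : E m s -> a n s = m%:R / n.+1%:R.
    rewrite /E /I /= !in_itv/= ler_pdivrMr// ltr_pdivlMr// => -[_] mn.
    by rewrite /a; congr (_%:R / _); apply: truncn_def; rewrite mulrC.
  have -> : I = \bigcup_m E m.
    apply/seteqP; split => [s Is|s [m _ []]//].
    exists (Num.truncn (n.+1%:R * s)) => //; split => //=.
    have s0 : 0 < s by move: Is; rewrite /I /= in_itv/= => /andP[].
    by have := aE n s s0; rewrite in_itv/= /a -[(Num.truncn _).+1%:R]natr1 mulrDl mul1r.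
  apply/measurable_fun_bigcup => // m.
  apply: (@eq_measurable_fun _ _ _ _ _ (fun s => v s (x (m%:R / n.+1%:R)))).
    by move=> s; rewrite inE => /aEm ->.
  have [[s Es]|nE] := pselect (E m !=set0); last first.
    have -> : E m = set0 by rewrite -subset0 => s Es; apply: nE; exists s.
    exact: measurable_fun_set0.
  have [h _ _ _ _] := v_ok.
  apply: (@measurable_funS _ _ _ _ I) => //; first by move=> u [].
  apply: h; rewrite -(aEm _ _ Es); apply: rx; apply: aT.
  by case: Es; rewrite /I /= in_itv.
have conv s : I s -> forall e, 0 < e ->
    \forall n \near \oo, enorm (v s (x s) - v s (x (a n s))) < e.
  rewrite /I /= in_itv/= => sT e e0.
  have sp1 : 0 < speed s + 1 by have := speed_ge0 s; lra.
  have e1 : 0 < e / (speed s + 1) by rewrite divr_gt0.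
  have [d d0 hd] := ac_unif_continuous acx e1.
  near=> n.
  have nd : n.+1%:R^-1 < d by near: n; exact: near_infty_natSinv_lt (PosNum d0).
  have [s0 sT'] := andP sT; have /andP[a1 a2] := aE n s s0.
  have sT2 : 0 <= s <= T by lra.
  have xa : enorm (x s - x (a n s)) < e / (speed s + 1).
    apply: hd => //; first exact: aT.
    by rewrite ger0_norm ?subr_ge0// ltrBlDl (lt_trans a2)// ltrD2l.
  apply: le_lt_trans (velocity_lip sT (rx _ sT2) (rx _ (aT _ _ sT))) _.
  apply: (@le_lt_trans _ _ (speed s * enorm (x s - x (a n s)))).
    by rewrite ler_wpM2l ?speed_ge0// dist_le_enorm.
  rewrite ltr_pdivlMr// in xa; apply: le_lt_trans xa.
  by rewrite mulrC ler_wpM2l ?enorm_ge0//; lra.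
apply: (@eq_measurable_fun _ _ _ _ _ (fun s => ((v s (x s)).1, (v s (x s)).2))).
  by move=> s _; rewrite -surjective_pairing.
apply: measurable_fun_pair_on => //.
  apply: (@measurable_fun_cvg _ _ R I (fun n s => (v s (x (a n s))).1)).
    by move=> n; exact: (measurableT_comp (@measurable_fst _ _ _ _) (man n)).
  move=> s Is; apply/cvgrPdist_lt => e /(conv s Is); apply: filterS => n.
  exact: le_lt_trans (normr_fst_le_enorm (v s (x s) - v s (x (a n s)))).
apply: (@measurable_fun_cvg _ _ R I (fun n s => (v s (x (a n s))).2)).
  by move=> n; exact: (measurableT_comp (@measurable_snd _ _ _ _) (man n)).
move=> s Is; apply/cvgrPdist_lt => e /(conv s Is); apply: filterS => n.
exact: le_lt_trans (normr_snd_le_enorm (v s (x s) - v s (x (a n s)))).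
Unshelve. all: by end_near. Qed.

End Velocity.

(** * Stability of trajectories *)

Section Trajectories.
Context {R : realType} (D : domain R) (T : R) (v Phi : R -> plane R -> plane R).
Hypotheses (D_ok : admissible_domain D) (T_gt0 : 0 < T)
  (v_ok : admissible_velocity D T v) (Phi_flow : is_flow D T v Phi).

Let L := speed D v \_ `]0, T[.

Let intL : (leb1 R).-integrable setT (EFin \o L).
Proof. by apply: integrable_restrict_itv; exact: integrable_speed. Qed.

Let L_ge0 s : 0 <= L s.
Proof. by rewrite /L /patch; case: ifP => // _; exact: speed_ge0. Qed.

Lemma Lam0 : Lam D v 0 = 0.
Proof. by rewrite /Lam set_itvoo0 integral_set0. Qed.

Lemma ler_Lam s t : s <= t -> t <= T -> Lam D v s <= Lam D v t.
Proof.
move=> st tT; rewrite !(Lam_cumul D_ok v_ok) ?(le_trans st)//.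
exact: ler_cumul.
Qed.

Lemma Lam_ge0 t : 0 <= t -> t <= T -> 0 <= Lam D v t.
Proof. by move=> t0 tT; rewrite -Lam0; exact: ler_Lam. Qed.

Lemma measurable_Lam t : t <= T ->
  measurable_fun (`]0, t[%classic : set (measurableTypeR R)) (Lam D v : R -> measurableTypeR R).
Proof.
move=> tT; apply: (@eq_measurable_fun _ _ _ _ _ (cumul L)).
  move=> s; rewrite inE/= in_itv/= => /andP[s0 st].
  by rewrite (Lam_cumul D_ok v_ok)// (le_trans (ltW st)).
by apply: measurable_funTS; exact: measurable_cumul.
Qed.

(** The curve z = x + k - Phi y satisfies |z'| <= L |z| + e almost everywhere,
    because translating x by a period does not change the distance of its
    points to those of the other trajectory. *)
Lemma trajectory_enorm_le x e y k t :
  absolutely_continuous_on 0 T x ->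
  (forall s, 0 <= s <= T -> representative D (x s)) ->
  measurable_fun (`]0, T[%classic : set (measurableTypeR R)) (e : R -> measurableTypeR R) ->
  (forall s, 0 < s < T -> 0 <= e s) ->
  {ae leb1 R, forall s, 0 < s < T ->
     exists2 p, vderive x s p & enorm (p - v s (x s)) <= e s} ->
  carrier D y -> periods D k -> 0 <= t <= T ->
  ((enorm (x t + k - Phi t y))%:E <=
     (expR (Lam D v t) * enorm (x 0 + k - y))%:E +
     \int[leb1 R]_(s in `]0%R, t[) (expR (Lam D v t - Lam D v s) * e s)%:E)%E.
Proof.
move=> acx rx me e0 dx Cy pk /andP[t0 tT].
have [Phi0 Phir Phiac Phid] := Phi_flow Cy.
have It s : `]0, t[%classic s -> 0 < s < T.
  by rewrite /= in_itv/= => /andP[-> st]; exact: lt_le_trans tT.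
have mIt : measurable (`]0, t[%classic : set (measurableTypeR R)) by exact: measurable_itv.
have met : measurable_fun (`]0, t[%classic : set (measurableTypeR R)) (e : R -> measurableTypeR R).
  by apply: measurable_funS me => //; move=> s /It; rewrite /= in_itv.
have mint : measurable_fun (`]0, t[%classic : set (measurableTypeR R))
    (fun s => (expR (Lam D v t - Lam D v s) * e s)%:E).
  apply/measurable_EFinP; apply: measurable_funM => //.
  apply: measurableT_comp => //; apply: measurable_funB => //.
  exact: measurable_Lam.
set J := (\int[leb1 R]_(s in _) _)%E.
(* If the integral of the defect diverges there is nothing to prove; otherwise
   the defect is integrable and Gronwall's inequality applies. *)
have [->|Jfin] := eqVneq J +oo%E; first by rewrite addeC addye// leey.
have J0 : (0 <= J)%E.
  by apply: integral_ge0 => s /It sT; rewrite lee_fin mulr_ge0 ?expR_ge0 ?e0.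
have inte : (leb1 R).-integrable `]0, t[ (EFin \o e).
  apply/integrableP; split; first exact/measurable_EFinP.
  apply: (@le_lt_trans _ _ J); last by rewrite ltey.
  apply: ge0_le_integral => //.
  - by apply: measurableT_comp => //; exact/measurable_EFinP.
  - move=> s Is; have sT := It s Is; rewrite /= lee_fin ger0_norm ?e0//.
    rewrite ler_peMl ?e0// -expR0 ler_expR subr_ge0.
    by move: Is; rewrite /= in_itv/= => /andP[_ st]; apply: ler_Lam => //; exact: ltW.
pose q := e \_ `]0, t[.
have intq : (leb1 R).-integrable setT (EFin \o q) by exact: integrable_restrict_itv.
have q0 s : 0 <= q s.
  by rewrite /q /patch; case: ifPn => //; rewrite inE => /It/e0.
pose z s := x s + k - Phi s y.
have acz : absolutely_continuous_on 0 t z.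
  apply: (@absolutely_continuous_onS _ 0 T) => //.
  by apply: absolutely_continuous_onB => //; exact: absolutely_continuous_onDr.
have dz : {ae leb1 R, forall s, 0 < s < t ->
    exists2 p, vderive z s p & enorm p <= L s * enorm (z s) + q s}.
  refine (@filterS2 _ _ (ae_filter_ringOfSetsType (leb1 R)) _ _ _ _ dx Phid) => s dxs dPs st.
  have sT : 0 < s < T by move: st => /andP[-> /lt_le_trans]; exact.
  have sT' : 0 <= s <= T by case/andP: sT => *; rewrite !ltW.
  have [p [dx1 dx2] pe] := dxs sT; have [dP1 dP2] := dPs sT.
  exists (p - v s (Phi s y)).
    split.
      have := is_deriveB (is_deriveD dx1 (is_derive_cst (k.1 : R) s (1 : R))) dP1.
      by rewrite addr0.
    have := is_deriveB (is_deriveD dx2 (is_derive_cst (k.2 : R) s (1 : R))) dP2.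
    by rewrite addr0.
  have -> : L s = speed D v s by rewrite /L /patch mem_set//= in_itv.
  have -> : q s = e s by rewrite /q /patch mem_set//= in_itv.
  apply: le_trans (ler_enormB _ (v s (x s)) _) _.
  rewrite [leLHS]addrC lerD//.
  apply: le_trans (velocity_lip D_ok v_ok sT (rx _ sT') (Phir _ sT')) _.
  rewrite ler_wpM2l ?speed_ge0//.
  have := dist_le D_ok (x s) (Phi s y) (periodsN pk).
  by rewrite opprK addrAC.
have := gronwall t0 intL L_ge0 intq q0 acz dz.
rewrite -!(Lam_cumul D_ok v_ok) ?(ltW T_gt0)// Lam0 oppr0 expR0 mul1r.
set G := Rintegral _ _ _ => hG.
have GJ : (expR (Lam D v t) * G)%:E = J.
  have iQ := integrable_expRN_cumul intL L_ge0 intq.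
  rewrite /G -Rintegral_itv_bndo_bndc; last by apply: integrableS iQ.
  rewrite -RintegralZl//; last by apply: integrableS iQ.
  rewrite /Rintegral fineK; last first.
    apply: integrable_fin_num => //.
    have iQt : (leb1 R).-integrable `]0, t[
       (EFin \o (fun s => expR (- cumul L s) * q s)) by apply: integrableS iQ.
    exact: (integrableZl mIt (expR (Lam D v t)) iQt).
  apply: eq_integral => s; rewrite inE => Is; congr (_%:E).
  have -> : q s = e s by rewrite /q /patch mem_set.
  have sT := It s Is.
  have -> : Lam D v s = cumul L s.
    by apply: (Lam_cumul D_ok v_ok); case/andP: sT => _ /ltW.
  by rewrite mulrA -expRD.
rewrite -GJ -EFinD lee_fin -mulrDr -/(z t).
have z0E : z 0 = x 0 + k - y by rewrite /z Phi0.
rewrite -z0E; have := ler_wpM2l (expR_ge0 (Lam D v t)) hG.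
by rewrite mulrA -expRD subrr expR0 mul1r.
Qed.

(** Two trajectories of the flow: one of them is an approximate trajectory with
    zero defect. *)
Lemma flow_lip t y y' : 0 <= t <= T -> carrier D y -> carrier D y' ->
  enorm (Phi t y - Phi t y') <= expR (Lam D v t) * enorm (y - y').
Proof.
move=> tT Cy Cy'; have [Phi0 Phir Phiac Phid] := Phi_flow Cy.
have := @trajectory_enorm_le (fun s => Phi s y) (fun=> 0) y' 0 t Phiac Phir.
have mc : measurable_fun (`]0, T[%classic : set (measurableTypeR R))
   ((fun=> 0) : R -> measurableTypeR R) by exact: measurable_cst.
move=> /(_ mc (fun _ _ => lexx _) _ Cy' (periods0 D) tT).
rewrite !addr0 Phi0 integral0_eq ?adde0 ?lee_fin; last by move=> s _; rewrite mulr0.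
apply; apply: (@filterS _ _ (ae_filter_ringOfSetsType (leb1 R))) Phid => s h sT.
by exists (v s (Phi s y)); [exact: h|rewrite subrr enorm0].
Qed.

(** Translate the lift of x by the period that realizes the distance at time
    0. *)
Lemma trajectory_dist_le x e y t :
  absolutely_continuous_on 0 T x ->
  (forall s, 0 <= s <= T -> representative D (x s)) ->
  measurable_fun (`]0, T[%classic : set (measurableTypeR R)) (e : R -> measurableTypeR R) ->
  (forall s, 0 < s < T -> 0 <= e s) ->
  {ae leb1 R, forall s, 0 < s < T ->
     exists2 p, vderive x s p & enorm (p - v s (x s)) <= e s} ->
  carrier D y -> 0 <= t <= T ->
  ((dist D (x t) (Phi t y))%:E <=
     (expR (Lam D v t) * dist D (x 0) y)%:E +
     \int[leb1 R]_(s in `]0%R, t[) (expR (Lam D v t - Lam D v s) * e s)%:E)%E.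
Proof.
move=> acx rx me e0 dx Cy tT.
have [k pk ->] := dist_attained D_ok (x 0) y.
have := trajectory_enorm_le acx rx me e0 dx Cy (periodsN pk) tT.
rewrite (addrAC (x 0)); apply: le_trans; rewrite lee_fin.
have := dist_le D_ok (x t) (Phi t y) pk.
by rewrite addrAC.
Qed.

End Trajectories.

(** * Integrals of nonnegative functions and couplings *)

(** The integral of a nonnegative function is the supremum of the integrals of
    the simple functions below it, hence monotone even for functions that are not
    measurable. *)
Lemma ge0_le_integral_lower d (T : measurableType d) (R : realType)
    (mu : {measure set T -> \bar R}) (A B : set T) (f g : T -> \bar R) :
  A `<=` B -> (forall x, A x -> 0 <= f x)%E -> (forall x, B x -> 0 <= g x)%E ->
  (forall x, A x -> f x <= g x)%E ->
  (\int[mu]_(x in A) f x <= \int[mu]_(x in B) g x)%E.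
Proof.
move=> AB f0 g0 fg; rewrite !ge0_integralE//.
apply: le_ereal_sup => _ [h hf <-]; exists h => // x.
apply: le_trans (hf x) _; rewrite /patch.
case: ifPn => [|_]; last by case: ifPn => //; rewrite inE => /g0.
by rewrite inE => Ax; rewrite ifT ?inE//; [exact: fg|exact: AB].
Qed.

Lemma ae_ge0_le_integral_lower d (T : measurableType d) (R : realType)
    (mu : {measure set T -> \bar R}) (A : set T) (f g : T -> \bar R) :
  measurable A -> (forall x, A x -> 0 <= f x)%E -> (forall x, A x -> 0 <= g x)%E ->
  measurable_fun A f -> {ae mu, forall x, A x -> (f x <= g x)%E} ->
  (\int[mu]_(x in A) f x <= \int[mu]_(x in A) g x)%E.
Proof.
move=> mA f0 g0 mf [B [mB B0 subB]].
rewrite (ge0_negligible_integral mB mA mf f0 B0).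
apply: ge0_le_integral_lower => // x [Ax nBx]; first exact: f0.
have [//|nfg] := pselect (f x <= g x)%E.
by exfalso; apply: nBx; apply: subB => /= /(_ Ax).
Qed.

Section DensityMeasure.
Context d (T : measurableType d) (R : realType) (mu : {measure set T -> \bar R}).
Variable r : T -> \bar R.
Local Open Scope ereal_scope.

(** The hypotheses are arguments, so that the measure structure attached to this
    set function can be inferred. *)
Definition density_measure (ir : mu.-integrable setT r) (r0 : forall x, 0 <= r x)
  : set T -> \bar R := fun A => \int[mu]_(x in A) r x.

Variables (ir : mu.-integrable setT r) (r0 : forall x, 0 <= r x).
Notation nu := (density_measure ir r0).

Let nu0 : nu set0 = 0. Proof. exact: integral_set0. Qed.

Let nu_ge0 A : 0 <= nu A. Proof. by apply: integral_ge0 => x _; exact: r0. Qed.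

Let nu_sigma_additive : semi_sigma_additive nu.
Proof. by apply: semi_sigma_additive_nng_induced => //; exact: measurable_int ir. Qed.

HB.instance Definition _ := isMeasure.Build _ _ _ nu nu0 nu_ge0 nu_sigma_additive.

Let nu_fin : fin_num_fun nu.
Proof. by move=> A mA; apply: integrable_fin_num => //; exact: integrableS ir. Qed.

HB.instance Definition _ := Measure_isFinite.Build _ _ _ nu nu_fin.

End DensityMeasure.

Section ImageMeasure.
Context d d' (S : measurableType d) (T : measurableType d') (R : realType).
Variables (m : {measure set S -> \bar R}) (f : S -> T).
Local Open Scope ereal_scope.

(** Carries the measurability of f as an argument, for the same reason as
    [density_measure]. *)
Definition image_measure (mf : measurable_fun setT f) : set T -> \bar R :=
  fun A => m (f @^-1` A).

Variable mf : measurable_fun setT f.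
Notation nu := (image_measure mf).

Let preim A : measurable A -> measurable (f @^-1` A).
Proof. by move=> mA; rewrite -[X in measurable X]setTI; exact: mf. Qed.

Let nu0 : nu set0 = 0. Proof. by rewrite /image_measure preimage_set0 measure0. Qed.

Let nu_ge0 A : 0 <= nu A. Proof. exact: measure_ge0. Qed.

Let nu_sigma_additive : semi_sigma_additive nu.
Proof.
move=> F mF tF mUF; rewrite /image_measure preimage_bigcup.
apply: measure_semi_sigma_additive.
- by move=> n; exact: preim.
- apply/trivIsetP => /= i j _ _ ij; rewrite -preimage_setI.
  by move/trivIsetP : tF => /(_ _ _ _ _ ij) ->//; rewrite preimage_set0.
- by rewrite -preimage_bigcup; exact: preim.
Qed.

HB.instance Definition _ := isMeasure.Build _ _ _ nu nu0 nu_ge0 nu_sigma_additive.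

End ImageMeasure.

Section Coupling.
Context {R : realType} (D : domain R).
Hypothesis D_ok : admissible_domain D.
Local Open Scope ereal_scope.

Lemma measurable_dist :
  measurable_fun setT (fun z : plane R * plane R => dist D z.1 z.2 : measurableTypeR R).
Proof.
have dE (x y : plane R) : dist D x y = dist D (x - y)%R 0%R.
  by rewrite /dist; case: D => *; rewrite subr0.
have md : measurable_fun setT (fun x : plane R => dist D x 0%R : measurableTypeR R).
  apply: (@lipschitz_measurable_fun _ _ _ 1%R) => // x y _ _.
  by rewrite mul1r; exact: dist_lipl.
have mB : measurable_fun setT (fun z : plane R * plane R => (z.1 - z.2)%R : plane R).
  apply: (@eq_measurable_fun _ _ _ _ _ (fun z : plane R * plane R =>
     ((z.1.1 : R) - z.2.1, (z.1.2 : R) - z.2.2)%R)).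
    by move=> z _.
  have m1 := @measurable_fst _ _ (plane R) (plane R).
  have m2 := @measurable_snd _ _ (plane R) (plane R).
  have n1 := @measurable_fst _ _ (measurableTypeR R) (measurableTypeR R).
  have n2 := @measurable_snd _ _ (measurableTypeR R) (measurableTypeR R).
  apply: measurable_fun_pair; apply: measurable_funB.
  - exact: measurableT_comp n1 m1.
  - exact: measurableT_comp n1 m2.
  - exact: measurableT_comp n2 m1.
  - exact: measurableT_comp n2 m2.
apply: (@eq_measurable_fun _ _ _ _ _
  ((fun x : plane R => dist D x 0%R : measurableTypeR R) \o
   (fun z : plane R * plane R => (z.1 - z.2)%R : plane R))).
  by move=> z _ /=; rewrite -dE.
exact: measurableT_comp md mB.
Qed.

(** The coupling is the sum over i of the images under (x, y) |-> (x, f y) of the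
    product measures with densities a_i and b_i. Almost all of the i-th product
    measure sits on P_i * Q_i, where the cost is at most C_i. *)
Lemma W1_le_pieces (N : nat) (mu nu : set (plane R) -> \bar R)
    (a b : 'I_N -> plane R -> \bar R) (f : plane R -> plane R)
    (P Q : 'I_N -> set (plane R)) (C : 'I_N -> \bar R) :
  (forall i, (leb2 R).-integrable setT (a i)) ->
  (forall i, (leb2 R).-integrable setT (b i)) ->
  (forall i x, 0 <= a i x) -> (forall i x, 0 <= b i x) ->
  (forall i, \int[leb2 R]_x a i x = 1) ->
  measurable_fun setT f ->
  (forall i, measurable (P i)) -> (forall i, measurable (Q i)) ->
  (forall i x, ~ P i x -> a i x = 0) -> (forall i x, ~ Q i x -> b i x = 0) ->
  (forall A, measurable A -> mu A =
     \sum_(i < N) (\int[leb2 R]_x b i x) * \int[leb2 R]_(x in A) a i x) ->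
  (forall A, measurable A -> nu A =
     \sum_(i < N) \int[leb2 R]_(x in f @^-1` A) b i x) ->
  (forall i, 0 <= C i) ->
  (forall i x y, P i x -> Q i y -> (dist D x (f y))%:E <= C i) ->
  W1 D mu nu <= \sum_(i < N) (\int[leb2 R]_x b i x) * C i.
Proof.
move=> ia ib a0 b0 a1 mf mP mQ aP bQ muE nuE C0 dC.
pose ma i := density_measure (ia i) (a0 i).
pose mb i := density_measure (ib i) (b0 i).
pose theta (z : plane R * plane R) := (z.1, f z.2).
have mtheta : measurable_fun setT theta.
  apply: measurable_fun_pair; first exact: measurable_fst.
  exact: measurableT_comp mf (@measurable_snd _ _ _ _).
pose pi_ i : {measure set (plane R * plane R) -> \bar R} :=
  image_measure (ma i \x mb i) mtheta.
(* Finite sums of measures are indexed by natural numbers; indices from N on are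
   sent to the null measure. *)
pose m_ (n : nat) : {measure set (plane R * plane R) -> \bar R} :=
  if insub n is Some i then pi_ i else mzero.
pose pi : {measure set (plane R * plane R) -> \bar R} := msum m_ N.
have m_E (i : 'I_N) : m_ i = pi_ i by rewrite /m_ valK.
have piE A : pi A = \sum_(i < N) pi_ i A.
  by rewrite /pi /= /msum; apply: eq_bigr => i _; rewrite m_E.
have pi_X i (A B : set (plane R)) : measurable A -> measurable B ->
    pi_ i (A `*` B) = \int[leb2 R]_(x in A) a i x * \int[leb2 R]_(x in f @^-1` B) b i x.
  move=> mA mB; rewrite -[LHS]/((ma i \x mb i) (A `*` (f @^-1` B))).
  rewrite product_measure1E//.
  by rewrite -[X in measurable X]setTI; exact: mf.
have pi_coupling : coupling mu nu pi.
  move=> A mA; rewrite !piE muE// nuE//; split; apply: eq_bigr => i _.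
    by rewrite pi_X// preimage_setT muleC.
  by rewrite pi_X// a1 mul1e.
apply: (@le_trans _ _ (\int[pi]_z (dist D z.1 z.2)%:E)).
  by apply: ereal_inf_lbound; exists pi.
have md : measurable_fun setT (fun z : plane R * plane R => (dist D z.1 z.2)%:E).
  by apply/measurable_EFinP; exact: measurable_dist.
rewrite ge0_integral_measure_sum//; last by move=> z _; rewrite lee_fin dist_ge0.
apply: lee_sum => i _; rewrite m_E.
have piT : pi_ i setT = \int[leb2 R]_x b i x.
  by rewrite -setXTT pi_X// preimage_setT a1 mul1e.
rewrite -piT muleC -integral_cst//.
apply: ae_ge0_le_integral => //.
- by move=> z _; rewrite lee_fin dist_ge0.
- by move=> z _; exact: C0.
have mS : measurable [set z : plane R * plane R | C i < (dist D z.1 z.2)%:E].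
  by rewrite -[X in measurable X]setTI; exact: emeasurable_fun_o_infty.
have mtS : measurable (theta @^-1` [set z | C i < (dist D z.1 z.2)%:E]).
  by rewrite -[X in measurable X]setTI; exact: (mtheta measurableT _ mS).
exists [set z | C i < (dist D z.1 z.2)%:E]; split => //; last first.
  by move=> z /= h; rewrite ltNge; apply/negP => le; apply: h.
(* Outside U1 and U2 both points are where the cost is controlled. *)
pose U1 : set (plane R * plane R) := (~` P i) `*` setT.
pose U2 : set (plane R * plane R) := setT `*` (~` Q i).
have mU1 : measurable U1 by apply: measurableX => //; exact: measurableC.
have mU2 : measurable U2 by apply: measurableX => //; exact: measurableC.
apply/eqP; rewrite -measure_le0 -[X in X <= _]/((ma i \x mb i) (theta @^-1` _)).
apply: (@le_trans _ _ ((ma i \x mb i) (U1 `|` U2))).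
  apply: le_measure; rewrite ?inE//; first exact: measurableU.
  move=> [x y] /=; rewrite /theta /= => Cxy.
  have [Px|nPx] := pselect (P i x); last by left; split.
  right; split => //= Qy; have := dC _ _ _ Px Qy.
  by rewrite leNgt Cxy.
have e1 : (ma i \x mb i) U1 = 0.
  rewrite product_measure1E//; last exact: measurableC.
  rewrite [X in X * _](_ : _ = 0) ?mul0e//.
  by apply: integral0_eq => x; exact: aP.
have e2 : (ma i \x mb i) U2 = 0.
  rewrite product_measure1E//; last exact: measurableC.
  rewrite [X in _ * X](_ : _ = 0) ?mule0//.
  by apply: integral0_eq => x; exact: bQ.
apply: (le_trans (measureU2 _ mU1 mU2)).
by rewrite [X in X + _]e1 [X in _ + X]e2 adde0.
Qed.

End Coupling.

(** * The error estimate *)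

Section Estimate.
Context {R : realType} (D : domain R) (T : R) (v : R -> plane R -> plane R)
  (rho0 : plane R -> R) (Phi : R -> plane R -> plane R).
Hypotheses (D_ok : admissible_domain D) (T_gt0 : 0 < T)
  (v_ok : admissible_velocity D T v)
  (rho0_L1 : (leb2 R).-integrable (carrier D) (fun x => (rho0 x)%:E))
  (rho0_ge0 : forall x, carrier D x -> 0 <= rho0 x)
  (Phi_flow : is_flow D T v Phi).
Variables (N : nat) (alpha : R -> R) (w X : 'I_N -> R -> plane R).
Hypotheses (N_gt0 : (0 < N)%N) (sol : is_solution D T alpha w X).

Local Notation M := (mass D rho0 X).
Local Notation Omega t := (cell D (conf X t)).

Lemma conf_representative t : 0 <= t <= T -> forall i, representative D (conf X t i).
Proof. by move=> tT i; case: sol => _ _ h _ _; exact: (h i).2. Qed.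

Lemma conf_distinct t : 0 <= t <= T ->
  forall i j, i != j -> ~ same_point D (conf X t i) (conf X t j).
Proof. by move=> tT i j ij; case: sol => _ _ _ h _; exact: h. Qed.

Let zeroT : 0 <= (0 : R) <= T. Proof. by rewrite lexx ltW. Qed.

Lemma integrable_rho0_cell i : (leb2 R).-integrable (Omega 0 i) (fun x => (rho0 x)%:E).
Proof.
apply: integrableS rho0_L1; [exact: measurable_carrier|exact: measurable_cell|].
by move=> x [].
Qed.

Lemma massE i : (M i)%:E = (\int[leb2 R]_(x in Omega 0 i) (rho0 x)%:E)%E.
Proof.
rewrite /mass /Rintegral fineK//; apply: integrable_fin_num; first exact: measurable_cell.
exact: integrable_rho0_cell.
Qed.

Lemma mass_ge0 i : 0 <= M i.
Proof. by apply: Rintegral_ge0 => x [/rho0_ge0]. Qed.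

(** The total mass thus depends on rho0 only, which makes the bounds of a whole
    family of discretizations comparable. *)
Lemma total_massE : (total_mass D rho0 X)%:E =
  (\int[leb2 R]_(x in carrier D) (rho0 x)%:E)%E.
Proof.
rewrite /total_mass -sumEFin -[X in integral _ X]setIT.
rewrite (integral_cells D_ok N_gt0 (conf_distinct zeroT))//.
- by apply: eq_bigr => i _; rewrite setIT massE.
- by move/integrableP : rho0_L1 => [].
Qed.

Lemma max_diam_le_d_h t : 0 <= t <= T -> max_diam D (conf X t) <= d_h D T X.
Proof.
move=> tT; have [K K0 dK] := dist_bounded D_ok.
apply: ub_le_sup; last by exists t => //=; rewrite in_itv.
by exists K => _ [s _ <-]; exact: max_diam_le.
Qed.

Lemma d_h_ge0 : 0 <= d_h D T X.
Proof.
apply: le_trans (max_diam_le_d_h zeroT).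
by rewrite /max_diam; elim/big_rec : _ => // i x _ x0; rewrite le_max x0 orbT.
Qed.

Lemma integral_uniform t i (A : set (plane R)) : measurable A ->
  (\int[leb2 R]_(x in A) ((area (Omega t i))^-1 * \1_(Omega t i) x)%:E =
   ((area (Omega t i))^-1)%:E * leb2 R (Omega t i `&` A))%E.
Proof.
move=> mA; have mO := measurable_cell D_ok (conf X t) i.
under eq_integral do rewrite EFinM.
rewrite ge0_integralZl_EFin//.
- by rewrite integral_indic.
- by apply/measurable_EFinP; exact: measurable_indic.
- by rewrite invr_ge0 fine_ge0.
Qed.

(** The transport map is extended arbitrarily outside the carrier to be
    measurable on the whole plane. *)
Lemma measurable_transport t : 0 <= t <= T ->
  measurable_fun setT ((reduce D \o Phi t) \_ (carrier D)).
Proof.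
move=> tT; have mC := measurable_carrier D_ok.
apply: (measurable_restrictT _ mC).1.
apply: (@measurable_comp _ _ _ _ _ _ (representative D)).
- exact: measurable_representative.
- by move=> _ [y Cy <-]; have [_ h _ _] := Phi_flow Cy; exact: h.
- exact: measurable_reduce.
- apply: (@lipschitz_measurable_fun_plane _ _ _ (expR (Lam D v t))) => //.
  by move=> y y' Cy Cy'; exact: (flow_lip D_ok T_gt0 v_ok Phi_flow tT Cy Cy').
Qed.

Local Notation I := (`]0, T[%classic : set (measurableTypeR R)).

Lemma measurable_forcing i : measurable_fun I (w i).
Proof.
have [_ /(_ i)[iw1 iw2] _ _ _] := sol.
move/measurable_int/measurable_EFinP : iw1 => m1.
move/measurable_int/measurable_EFinP : iw2 => m2.
apply: (@eq_measurable_fun _ _ _ _ _ (fun s => ((w i s).1, (w i s).2))).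
  by move=> s _; rewrite -surjective_pairing.
by apply: measurable_fun_pair_on => //; exact: measurable_itv.
Qed.

Lemma measurable_defect i :
  measurable_fun I (fun s => enorm (w i s - v s (X i s)) : measurableTypeR R).
Proof.
have mI : measurable I by exact: measurable_itv.
have [_ _ /(_ i)[acX rX] _ _] := sol.
apply: measurable_enorm => //; apply: measurable_fun_planeB => //.
  exact: measurable_forcing.
by apply: (measurable_along D_ok v_ok).
Qed.

(** The Borel substitute for the length of the centroid displacement is
    u = |g - w_i|, with g a Borel version of the velocity of the generator: the
    equation of motion says that x_i' - w_i is alpha times the displacement. *)
Lemma displacement_version i : exists u : R -> R,
  [/\ measurable_fun I (u : R -> measurableTypeR R), forall s, 0 <= u s,
    {ae leb1 R, forall s, 0 < s < T ->
       u s = alpha s * enorm (displacement D (conf X s) i)} &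
    {ae leb1 R, forall s, 0 < s < T -> exists2 p, vderive (X i) s p &
       enorm (p - v s (X i s)) <= enorm (w i s - v s (X i s)) + u s}].
Proof.
have mI : measurable I by exact: measurable_itv.
have [[_ al0] _ /(_ i)[acX rX] _ /(_ i) dX] := sol.
have [g mg gE] := derivative_version T_gt0 acX.
exists (fun s => enorm (g s - w i s)); split.
- apply: measurable_enorm => //; apply: measurable_fun_planeB => //.
    exact: measurable_funTS.
  exact: measurable_forcing.
- by move=> s; exact: enorm_ge0.
- apply: (@filterS _ _ (ae_filter_ringOfSetsType (leb1 R))) dX => s dXs sT.
  rewrite (gE _ _ sT (dXs sT)) addrAC subrr add0r enormZ ger0_norm//; exact: al0.
- apply: (@filterS _ _ (ae_filter_ringOfSetsType (leb1 R))) dX => s dXs sT.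
  eexists; first exact: dXs.
  rewrite (gE _ _ sT (dXs sT)) addrAC; apply: le_trans (ler_enormD _ _) _.
  by rewrite (addrAC (w i s)) subrr add0r.
Qed.

Lemma defect_ge0 s : 0 <= E_h D v rho0 w X s.
Proof. by apply: sumr_ge0 => i _; rewrite mulr_ge0 ?mass_ge0 ?enorm_ge0. Qed.

Lemma measurable_E_h : measurable_fun I (E_h D v rho0 w X : R -> measurableTypeR R).
Proof.
apply: measurable_sum => i; apply: measurable_funM => //; exact: measurable_defect.
Qed.

Lemma B_h_integrand_ge0 t s : 0 < s < T ->
  0 <= expR (Lam D v t - Lam D v s) * alpha s *
      \sum_(i < N) M i * enorm (displacement D (conf X s) i).
Proof.
move=> sT; have [[_ al0] _ _ _ _] := sol.
rewrite mulr_ge0 ?mulr_ge0 ?expR_ge0 ?al0//.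
by apply: sumr_ge0 => i _; rewrite mulr_ge0 ?mass_ge0 ?enorm_ge0.
Qed.

(** [W1_le_pieces] with uniform densities on the current cells and rho0 on the
    initial ones. The cost of the i-th piece is the sum of the distance to the
    generator, at most d_h, and of the bound of [trajectory_dist_le]. *)
Lemma W1_le (t : R) : 0 <= t <= T ->
  (W1 D (muh D rho0 X t) (transported D rho0 Phi t) <=
     (total_mass D rho0 X * (1 + expR (Lam D v t)) * d_h D T X)%:E
     + \int[leb1 R]_(s in `]0%R, t[)
         (expR (Lam D v t - Lam D v s) * E_h D v rho0 w X s)%:E
     + B_h D v rho0 alpha X t)%E.
Proof.
move=> tT; have /andP[t0 tleT] := tT.
have [u hu] := choice displacement_version.
have mu i : measurable_fun I (u i : R -> measurableTypeR R) by have [] := hu i.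
have u0 i s : 0 <= u i s by have [] := hu i.
have uE i := let: And4 _ _ h _ := hu i in h.
have uD i := let: And4 _ _ _ h := hu i in h.
have ItI : `]0, t[%classic `<=` I.
  by move=> s /=; rewrite !in_itv/= => /andP[-> st]; exact: lt_le_trans tleT.
have mIt : measurable (`]0, t[%classic : set (measurableTypeR R)) by exact: measurable_itv.
have mexp : measurable_fun (`]0, t[%classic : set (measurableTypeR R))
    (fun s => expR (Lam D v t - Lam D v s) : measurableTypeR R).
  apply: measurableT_comp => //; apply: measurable_funB => //.
  exact: (measurable_Lam D_ok v_ok).
have mint (k : R -> R) : measurable_fun I (k : R -> measurableTypeR R) ->
    measurable_fun (`]0, t[%classic : set (measurableTypeR R))
      (fun s => (expR (Lam D v t - Lam D v s) * k s)%:E).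
  move=> mk; apply/measurable_EFinP; apply: measurable_funM => //.
  exact: measurable_funS mk.
pose e i s := enorm (w i s - v s (X i s)) + u i s.
have me i : measurable_fun I (e i : R -> measurableTypeR R).
  by apply: measurable_funD; [exact: measurable_defect|exact: mu].
have e0 i s : 0 <= e i s by rewrite addr_ge0// enorm_ge0.
pose J i := (\int[leb1 R]_(s in `]0%R, t[) (expR (Lam D v t - Lam D v s) * e i s)%:E)%E.
have J0 i : (0 <= J i)%E.
  by apply: integral_ge0 => s _; rewrite lee_fin mulr_ge0 ?expR_ge0.
pose c := (1 + expR (Lam D v t)) * d_h D T X.
have c0 : 0 <= c by rewrite mulr_ge0 ?d_h_ge0// addr_ge0// expR_ge0.
pose a i (x : plane R) := ((area (Omega t i))^-1 * \1_(Omega t i) x)%:E.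
pose b i := (fun x => (rho0 x)%:E) \_ (Omega 0 i).
pose f := (reduce D \o Phi t) \_ (carrier D).
have mf : measurable_fun setT f by exact: measurable_transport.
have mO s i := measurable_cell D_ok (conf X s) i.
have ib i : (leb2 R).-integrable setT (b i).
  exact: (integrable_mkcond _ (mO 0 i)).1 (integrable_rho0_cell i).
have b0 i x : (0 <= b i x)%E.
  rewrite /b /patch; case: ifPn => //; rewrite inE => -[Cx _].
  by rewrite lee_fin rho0_ge0.
have bT i : (\int[leb2 R]_x b i x = (M i)%:E)%E by rewrite -integral_mkcond massE.
have a0 i x : (0 <= a i x)%E.
  by rewrite lee_fin mulr_ge0// invr_ge0 fine_ge0.
have aA i (A : set (plane R)) : measurable A -> (\int[leb2 R]_(x in A) a i x =
    ((area (Omega t i))^-1)%:E * leb2 R (Omega t i `&` A))%E.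
  by move=> mA; exact: integral_uniform.
have aT i : (\int[leb2 R]_x a i x = 1)%E.
  rewrite aA// setIT leb2_cell// -EFinM mulVf// gt_eqF//.
  by apply: area_cell_gt0 => //; [exact: conf_representative|exact: conf_distinct].
have ma i : measurable_fun setT (a i).
  by apply/measurable_EFinP; apply: measurable_funM => //; exact: measurable_indic.
have ia i : (leb2 R).-integrable setT (a i).
  apply/integrableP; split => //.
  under eq_integral do rewrite gee0_abs//.
  by rewrite aT ltry.
have key := @W1_le_pieces R D D_ok N (muh D rho0 X t) (transported D rho0 Phi t)
  a b f (Omega t) (Omega 0) (fun i => c%:E + J i)%E ia ib a0 b0 aT mf (mO t) (mO 0).
apply: (le_trans (key _ _ _ _ _ _)).
- move=> i x nx; rewrite /a indicE memNset//.
  by rewrite mulr0.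
- by move=> i x nx; rewrite /b patchN// notin_setE.
- move=> A mA; have mCA : measurable (carrier D `&` A).
    by apply: measurableI => //; exact: measurable_carrier.
  rewrite /muh /density /rhoh.
  under eq_integral => x _ do rewrite -sumEFin.
  rewrite ge0_integral_sum//; last 2 first.
  + by move=> i; apply/measurable_EFinP; apply: measurable_funM.
  + move=> i x _; rewrite lee_fin mulr_ge0// mulr_ge0 ?mass_ge0//.
    by rewrite invr_ge0 fine_ge0.
  apply: eq_bigr => i _.
  transitivity (\int[leb2 R]_(x in carrier D `&` A) ((M i)%:E * a i x))%E.
    by apply: eq_integral => x _; rewrite /a -EFinM mulrA.
  rewrite ge0_integralZl_EFin ?mass_ge0//; last exact: measurable_funTS.
  rewrite bT !aA//; congr (_ * (_ * leb2 R _))%E.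
  by apply/seteqP; split => x [Ox]; [move=> [_ Ax]|move=> Ax]; split => //; split => //; case: Ox.
- move=> A mA; have mB : measurable (f @^-1` A).
    by rewrite -[X in measurable X]setTI; exact: mf.
  rewrite /transported /pushforward /density.
  have -> : carrier D `&` (reduce D \o Phi t) @^-1` A = carrier D `&` f @^-1` A.
    by apply/seteqP; split => x [Cx] /=; rewrite /f patchT ?inE.
  rewrite (integral_cells D_ok N_gt0 (conf_distinct zeroT))//.
  + by apply: eq_bigr => i _; rewrite integral_mkcondl.
  + by move/integrableP : rho0_L1 => [].
- by move=> i; rewrite adde_ge0// lee_fin.
- move=> i x y Ox Oy.
  have Cy : carrier D y by case: Oy.
  have fy : f y = reduce D (Phi t y) by rewrite /f patchT ?inE.
  have [_ rPhi _ _] := Phi_flow Cy.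
  have [_ pr] := reduce_spec D_ok (rPhi _ tT).
  rewrite fy -(dist_congr D_ok _ pr).
  have [_ _ /(_ i)[acX rX] _ _] := sol.
  have h := trajectory_dist_le D_ok T_gt0 v_ok Phi_flow acX rX (me i)
    (fun s _ => e0 i s) (uD i) Cy tT.
  have hx : dist D x (X i t) <= d_h D T X.
    apply: le_trans (max_diam_le_d_h tT).
    exact: (dist_generator_le D_ok (conf_representative tT) (conf_distinct tT)).
  have hy : dist D (X i 0) y <= d_h D T X.
    rewrite (distC D_ok); apply: le_trans (max_diam_le_d_h zeroT).
    exact: (dist_generator_le D_ok (conf_representative zeroT) (conf_distinct zeroT)).
  apply: (@le_trans _ _ ((dist D x (X i t))%:E + (dist D (X i t) (Phi t y))%:E)%E).
    by rewrite -EFinD lee_fin dist_triangle.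
  apply: (@le_trans _ _ ((d_h D T X)%:E + ((expR (Lam D v t) * d_h D T X)%:E + J i))%E).
    apply: leeD; first by rewrite lee_fin.
    apply: (le_trans h); apply: leeD => //.
    by rewrite lee_fin ler_wpM2l ?expR_ge0.
  by rewrite addeA -EFinD /c mulrDl mul1r.
under eq_bigr => i _ do rewrite bT ge0_muleDr ?lee_fin//.
rewrite big_split/= -addeA; apply: leeD.
  under eq_bigr => i _ do rewrite -EFinM.
  by rewrite sumEFin lee_fin -mulr_suml /c mulrA.
pose U s := \sum_(i < N) M i * u i s.
have mU : measurable_fun I (U : R -> measurableTypeR R).
  by apply: measurable_sum => i; apply: measurable_funM; [exact: measurable_cst|exact: mu].
have U0 s : 0 <= U s by apply: sumr_ge0 => i _; rewrite mulr_ge0 ?mass_ge0.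
have -> : (\sum_(i < N) (M i)%:E * J i =
    \int[leb1 R]_(s in `]0%R, t[) ((expR (Lam D v t - Lam D v s) * E_h D v rho0 w X s)%:E
      + (expR (Lam D v t - Lam D v s) * U s)%:E))%E.
  transitivity (\sum_(i < N) \int[leb1 R]_(s in `]0%R, t[)
      ((M i)%:E * (expR (Lam D v t - Lam D v s) * e i s)%:E))%E.
    apply: eq_bigr => i _; rewrite ge0_integralZl_EFin ?mass_ge0//.
    - by move=> s _; rewrite lee_fin mulr_ge0 ?expR_ge0.
    - exact: mint.
  rewrite -ge0_integral_sum//; last 2 first.
  - by move=> i; apply: measurable_funeM; exact: mint.
  - by move=> i s _; rewrite mule_ge0 ?lee_fin ?mass_ge0 ?mulr_ge0 ?expR_ge0.
  apply: eq_integral => s _.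
  under eq_bigr => i _ do rewrite -EFinM.
  rewrite sumEFin -EFinD -mulrDr /E_h /U -big_split/= mulr_sumr.
  by congr (_%:E); apply: eq_bigr => i _; rewrite /e; ring.
rewrite ge0_integralD//; last 4 first.
- by move=> s _; rewrite lee_fin mulr_ge0 ?expR_ge0 ?defect_ge0.
- by apply: mint; exact: measurable_E_h.
- by move=> s _; rewrite lee_fin mulr_ge0 ?expR_ge0.
- exact: mint.
apply: leeD => //; apply: ae_ge0_le_integral_lower => //.
- by move=> s _; rewrite lee_fin mulr_ge0 ?expR_ge0.
- move=> s /ItI; rewrite /= in_itv/= => sT; rewrite lee_fin.
  exact: B_h_integrand_ge0.
- exact: mint.
have uE' : {ae leb1 R, forall s, forall i, 0 < s < T ->
    u i s = alpha s * enorm (displacement D (conf X s) i)}.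
  by have := @filter_forall _ _ _ _ (ae_filter_ringOfSetsType (leb1 R)) uE.
apply: (@filterS _ _ (ae_filter_ringOfSetsType (leb1 R))) uE' => s us /ItI.
rewrite /= in_itv/= => sT; rewrite lee_fin -mulrA ler_wpM2l ?expR_ge0//.
rewrite mulr_sumr; apply: ler_sum => i _.
by rewrite us// mulrCA.
Qed.

(** The first and the last terms of [W1_le] are nondecreasing in t; in the middle
    one the exponential is at most e^{Lam T}. *)
Lemma W1_sup_le :
  (ereal_sup [set W1 D (muh D rho0 X t) (transported D rho0 Phi t) | t in `[0%R, T]] <=
     (total_mass D rho0 X * (1 + expR (Lam D v T)) * d_h D T X)%:E
     + (expR (Lam D v T))%:E * \int[leb1 R]_(s in `]0%R, T[) (E_h D v rho0 w X s)%:E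
     + B_h D v rho0 alpha X T)%E.
Proof.
apply: ge_ereal_sup => _ [t tT <-]; rewrite /= in_itv/= in tT.
have /andP[t0 tleT] := tT.
have sub : `]0, t[%classic `<=` (`]0, T[%classic : set R).
  by move=> s /=; rewrite !in_itv/= => /andP[-> st]; exact: lt_le_trans tleT.
have LtT : Lam D v t <= Lam D v T by exact: (ler_Lam D_ok v_ok).
apply: le_trans (W1_le tT) _; apply: leeD; first apply: leeD.
- rewrite lee_fin; apply: ler_wpM2r; first exact: d_h_ge0.
  apply: ler_wpM2l; first by apply: sumr_ge0 => i _; exact: mass_ge0.
  by rewrite lerD2l ler_expR.
- rewrite -ge0_integralZl_EFin ?expR_ge0//; last 2 first.
  + by move=> s _; rewrite lee_fin defect_ge0.
  + by apply/measurable_EFinP; exact: measurable_E_h.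
  apply: ge0_le_integral_lower => // s.
  + by move=> _; rewrite lee_fin mulr_ge0 ?expR_ge0 ?defect_ge0.
  + by move=> _; rewrite -EFinM lee_fin mulr_ge0 ?expR_ge0 ?defect_ge0.
  rewrite /= in_itv/= => /andP[s0 st]; rewrite lee_fin ler_wpM2r ?defect_ge0//.
  rewrite ler_expR lerBlDr (le_trans LtT)// lerDl.
  by apply: (Lam_ge0 D_ok v_ok); [exact: ltW|exact: le_trans (ltW st) tleT].
- apply: ge0_le_integral_lower; first exact: sub.
  + by move=> s /sub; rewrite /= in_itv/= => sT; rewrite lee_fin; exact: B_h_integrand_ge0.
  + by move=> s; rewrite /= in_itv/= => sT; rewrite lee_fin; exact: B_h_integrand_ge0.
  move=> s /sub; rewrite /= in_itv/= => sT; rewrite lee_fin.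
  have [[_ al0] _ _ _ _] := sol.
  apply: ler_wpM2r.
    by apply: sumr_ge0 => i _; apply: mulr_ge0; [exact: mass_ge0|exact: enorm_ge0].
  apply: ler_wpM2r; first exact: al0.
  by rewrite ler_expR lerD2r.
Qed.

End Estimate.

Lemma W1_ge0 (R : realType) (D : domain R) mu nu : admissible_domain D ->
  (0 <= W1 D mu nu)%E.
Proof.
move=> D_ok; apply: le_ereal_inf_tmp => _ [pi _ <-].
by apply: integral_ge0 => z _; rewrite lee_fin dist_ge0.
Qed.

Unset Implicit Arguments.

Theorem theorem2p1 (R : realType) (D : domain R) (T : R)
    (v : R -> plane R -> plane R) (rho0 : plane R -> R)
    (Phi : R -> plane R -> plane R)
    (D_ok : admissible_domain D)
    (T_gt0 : 0 < T)
    (v_ok : admissible_velocity D T v)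
    (rho0_L1 : (leb2 R).-integrable (carrier D) (fun x => (rho0 x)%:E))
    (rho0_ge0 : forall x, carrier D x -> 0 <= rho0 x)
    (Phi_flow : is_flow D T v Phi) :
  (forall (N : nat) (alpha : R -> R) (w X : 'I_N -> R -> plane R),
     (0 < N)%N ->
     is_solution D T alpha w X ->
     forall t : R, 0 <= t <= T ->
       (W1 D (muh D rho0 X t) (transported D rho0 Phi t) <=
          (total_mass D rho0 X * (1 + expR (Lam D v t)) * d_h D T X)%:E
          + \int[leb1 R]_(s in `]0%R, t[)
              (expR (Lam D v t - Lam D v s) * E_h D v rho0 w X s)%:E
          + B_h D v rho0 alpha X t)%E)
  /\
  (forall (I : Type) (F : set_system I) (FF : ProperFilter F)
     (N : I -> nat) (alpha : I -> R -> R)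
     (w X : forall h : I, 'I_(N h) -> R -> plane R),
     (forall h, (0 < N h)%N) ->
     (forall h, is_solution D T (alpha h) (w h) (X h)) ->
     mesh D (N h) @[h --> F] --> (0 : R) ->
     d_h D T (X h) @[h --> F] --> (0 : R) ->
     (\int[leb1 R]_(s in `]0%R, T[) (E_h D v rho0 (w h) (X h) s)%:E)%E
       @[h --> F] --> 0%E ->
     B_h D v rho0 (alpha h) (X h) T @[h --> F] --> 0%E ->
     ereal_sup [set W1 D (muh D rho0 (X h) t) (transported D rho0 Phi t)
                | t in `[0, T]]
       @[h --> F] --> 0%E).
Proof.
split=> [N alpha w X N0 sol t tT|I F FF N alpha w X N0 sol _ dh0 Eh0 Bh0].
  exact: W1_le.
pose m0 := fine (\int[leb2 R]_(x in carrier D) (rho0 x)%:E)%E.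
have mE h : total_mass D rho0 (X h) = m0.
  by rewrite /m0 -(total_massE D_ok T_gt0 rho0_L1 rho0_ge0 (N0 h) (sol h)).
pose c := m0 * (1 + expR (Lam D v T)).
apply: (@squeeze_cvge _ _ _ _ (cst 0%E) _ (fun h =>
  (c * d_h D T (X h))%:E + (expR (Lam D v T))%:E *
    (\int[leb1 R]_(s in `]0%R, T[) (E_h D v rho0 (w h) (X h) s)%:E)
  + B_h D v rho0 (alpha h) (X h) T)%E).
- apply: nearW => h; apply/andP; split.
    apply: (@le_trans _ _ (W1 D (muh D rho0 (X h) 0) (transported D rho0 Phi 0))).
      exact: W1_ge0.
    by apply: ereal_sup_ubound; exists 0 => //=; rewrite in_itv/= lexx ltW.
  by rewrite /c -(mE h); exact: W1_sup_le.
- exact: cvg_cst.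
have c1 : (c * d_h D T (X h))%:E @[h --> F] --> 0%E.
  apply: cvg_EFin; first exact: nearW.
  by rewrite -(mulr0 c); apply: cvgMr.
have c2 : ((expR (Lam D v T))%:E *
    (\int[leb1 R]_(s in `]0%R, T[) (E_h D v rho0 (w h) (X h) s)%:E))%E
    @[h --> F] --> 0%E.
  by rewrite -(mule0 (expR (Lam D v T))%:E); apply: cvgeZl.
rewrite -[0%E]adde0; apply: cvgeD => //.
by rewrite -[0%E]adde0; apply: cvgeD.
Qed.
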